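(* Let $(X,\omega)$ be a boundaryless smooth effective symplectic orbifold with a real orbifold polarization $P$, a prequantum line bundle $L$, and an orbifold half-form bundle $\delta_P$. Let $\mathcal{L}$ be a connected Lagrangian orbifold leaf of $P$. Assume that $L|_{\mathcal{L}}$ is equipped with its flat prequantum leafwise connection, that $\delta_P|_{\mathcal{L}}$ has the usual Maslov transport along smooth lifted leaf segments, and that these local transports are compatible with chart changes and isotropy actions, so that they define a corrected leafwise holonomy representation $$\operatorname{Hol}^{\mathrm{corr}}_{\mathcal{L}}\colon\pi_1^{\mathrm{orb}}(\mathcal{L},x_0)\longrightarrow U(1)$$ for the line $L\otimes\delta_P$. No global quotient presentation is assumed. Then a non-zero global polarized orbifold section of $(L\otimes\delta_P)|_{\mathcal{L}}$ exists if and only if $\operatorname{Hol}^{\mathrm{corr}}_{\mathcal{L}}$ is trivial. Equivalently, it is enough to check triviality on any generating set of the leafwise orbifold fundamental group; and whenever a generator is represented inside one uniformizing chart by a path $\tilde\gamma$ in a lifted leaf with $\tilde\gamma(0)=x_0$, $\tilde\gamma(1)=g\cdot x_0$, its condition is $$\frac{1}{2\pi\hbar}\int_{\tilde\gamma}\theta-\alpha_{s_0}(g)-\beta_{\nu_0}(g;x_0)-\frac{\mu(\tilde\gamma)}{4}\in\mathbb{Z}.$$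
   Context: Orbifold: a paracompact Hausdorff space $|X|$ with an atlas of uniformizing charts $(V,G,\pi)$, where $V$ is a connected open subset of Euclidean space, $G$ is a finite group acting smoothly and effectively on $V$, and $\pi:V\to|X|$ is $G$-invariant and induces a homeomorphism from $V/G$ onto an open set; charts are compatible via equivariant open embeddings. Orbifold forms, bundles and connections are families of $G$-invariant forms, $G$-equivariant bundles and $G$-equivariant connections on charts, compatible under chart embeddings; orbifold sections are compatible families of invariant sections. A symplectic orbifold carries a closed nondegenerate orbifold 2-form $\omega$; $\dim X=2n$. A prequantum line bundle is a Hermitian orbifold line bundle with unitary orbifold connection of curvature $-\frac{i}{\hbar}\omega$. $\Phi^L_g,\Phi^\delta_g$ denote the lifted actions of $g\in G$ on $L_V$ and $\delta_{P,V}$. A real orbifold polarization $P$ is a rank-$n$, Lagrangian, involutive complex orbifold subbundle of $TX\otimes\mathbb{C}$ with $P=\overline P$; its lifted leaves in charts are Lagrangian submanifolds, and its leaves in $X$ are obtained by gluing lifted leaves under chart embeddings and local group actions. $K_P=\bigwedge^nP^\circ$ with $P^\circ$ the annihilator of $P$; a half-form bundle is an orbifold line bundle $\delta_P$ with $\delta_P^{\otimes2}\cong K_P$ as orbifold line bundles; it carries a flat partial connection along $P$ induced from Lie differentiation on $K_P$. Maslov transport on $\delta_P$ (defined where $P$ is locally modeled by a Lagrangian fibration): parallel transport on smooth segments between caustics, and multiplication by $e^{-i\pi/2}$ at each signed caustic crossing, so that a reference frame $\nu_0$ that is base-aligned and parallel between caustics is transported along $\tilde\gamma$ to $e^{-i\pi\mu(\tilde\gamma)/2}\nu_0$,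 $\mu(\tilde\gamma)$ being the Maslov index (signed number of caustic crossings). The corrected leafwise transport on $L\otimes\delta_P$ is the tensor product of flat transport on $L$ with Maslov transport on $\delta_P$; the corrected holonomy of an orbifold loop in $\mathcal{L}$ (a sequence of paths in lifted leaves joined by chart changes and local group elements) is the composition of these transports with the induced identifications of fibers; for a single-chart loop $(\tilde\gamma,g)$ the closing identification is $\Phi^L_{g^{-1}}\otimes\Phi^\delta_{g^{-1}}$. A polarized orbifold section of $(L\otimes\delta_P)|_{\mathcal{L}}$ is one invariant under corrected leafwise transport and the orbifold identifications. In the last display: $\theta$ is a $G$-invariant local symplectic potential on $V$, $s_0$ a unitary frame of $L_V$ with $\nabla=d-\frac{i}{\hbar}\theta$, $\nu_0$ the reference half-form frame along $\tilde\gamma$, and $\Phi^L_g(s_0(x))=e^{2\pi i\alpha_{s_0}(g)}s_0(g\cdot x)$, $\Phi^\delta_g(\nu_0(x_0))=e^{2\pi i\beta_{\nu_0}(g;x_0)}\nu_0(g\cdot x_0)$ with $\alpha_{s_0}(g),\beta_{\nu_0}(g;x_0)\in\mathbb{R}/\mathbb{Z}$. *)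

(* Defs.v *)
Set Warnings "-redundant-canonical-projection,-notation-overridden,-ambiguous-paths,-notation-incompatible-prefix".
From HB Require Import structures.
From mathcomp Require Import all_boot all_order all_algebra all_fingroup.
From mathcomp Require Import generic_quotient.
From mathcomp Require Import all_classical all_reals all_analysis.
From mathcomp Require Import complex.

Set Implicit Arguments.
Unset Strict Implicit.
Unset Printing Implicit Defensive.
Import Order.TTheory GRing.Theory Num.Theory.
Import numFieldNormedType.Exports.
Local Open Scope classical_set_scope.
Local Open Scope ring_scope.
Local Open Scope complex_scope.

Section Smooth.
Context {R : realType}.

Fixpoint Ck_on {E F : normedModType R} (k : nat) (U : set E) (f : E -> F)
    : Prop :=
  match k with
  | 0%N => forall x, U x -> {for x, continuous f}
  | k'.+1 => (forall x, U x -> differentiable f x) /\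
             (forall v, Ck_on k' U (fun x => 'D_v f x))
  end.

(* Only meant for open U. *)
Definition smooth_on {E F : normedModType R} (U : set E) (f : E -> F) : Prop :=
  forall k, Ck_on k U f.

Definition csmooth_on {E : normedModType R} (U : set E) (f : E -> R[i]) : Prop :=
  smooth_on U (fun x => complex.Re (f x) : R^o) /\
  smooth_on U (fun x => complex.Im (f x) : R^o).

Definition mxRe {p q} (A : 'M[R[i]]_(p, q)) : 'M[R]_(p, q) :=
  map_mx (@complex.Re R) A.
Definition mxIm {p q} (A : 'M[R[i]]_(p, q)) : 'M[R]_(p, q) :=
  map_mx (@complex.Im R) A.
Definition cpx {p q} (A : 'M[R]_(p, q)) : 'M[R[i]]_(p, q) :=
  map_mx (real_complex R) A.
Definition mxconj {p q} (A : 'M[R[i]]_(p, q)) : 'M[R[i]]_(p, q) :=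
  map_mx (@conjc R) A.

Definition mxsmooth_on {E : normedModType R} {p q} (U : set E)
    (f : E -> 'M[R[i]]_(p, q)) : Prop :=
  smooth_on U (fun x => mxRe (f x)) /\ smooth_on U (fun x => mxIm (f x)).

Definition I_ : R[i] := Complex 0 1.

Definition cis (t : R) : R[i] := Complex (cos t) (sin t).

(* Directional derivatives of complex-valued functions, along real vectors
   (dC) and, extended complex-linearly, along complex vectors (dCC, dCm). *)
Definition dC {E : normedModType R} (f : E -> R[i]) (x v : E) : R[i] :=
  Complex ('D_v (fun y => complex.Re (f y) : R^o) x)
          ('D_v (fun y => complex.Im (f y) : R^o) x).

Definition dCC {m} (f : 'cV[R]_m -> R[i]) (x : 'cV[R]_m) (w : 'cV[R[i]]_m)
    : R[i] :=
  dC f x (mxRe w) + I_ * dC f x (mxIm w).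

Definition dCm {m p q} (f : 'cV[R]_m -> 'M[R[i]]_(p, q)) (x : 'cV[R]_m)
    (w : 'cV[R[i]]_m) : 'M[R[i]]_(p, q) :=
  \matrix_(r, s) dCC (fun y => f y r s) x w.

(* The complexified differential of f at x, applied to each column of W. *)
Definition tangent_map {m p} (f : 'cV[R]_m -> 'cV[R]_m) (x : 'cV[R]_m)
    (W : 'M[R[i]]_(m, p)) : 'M[R[i]]_(m, p) :=
  \matrix_(r, k) dCm (fun y => cpx (f y)) x (col k W) r 0.

End Smooth.

Definition paracompact (X : topologicalType) : Prop :=
  forall (I : Type) (A : I -> set X),
    (forall i, open (A i)) -> (forall x, exists i, A i x) ->
    exists (J : Type) (B : J -> set X),
      [/\ forall j, open (B j),
          forall x, exists j, B j x,
          forall j, exists i, B j `<=` A i &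
          forall x : X, exists2 N, nbhs x N &
            finite_set [set j | B j `&` N !=set0]].

Section Orbifold.
Context {R : realType}.

Notation E n := ('cV[R]_(2 * n)).

Record atlas (n : nat) (X : topologicalType) := Atlas {
  chart : Type;
  chart_dom : chart -> set (E n);
  chart_grp : chart -> finGroupType;
  chart_act : forall i, chart_grp i -> E n -> E n;
  chart_proj : chart -> E n -> X;
  dom_open : forall i, open (chart_dom i);
  dom_connected : forall i, connected (chart_dom i);
  dom_nonempty : forall i, chart_dom i !=set0;
  act_dom : forall i g x, chart_dom i x -> chart_dom i (@chart_act i g x);
  act_one : forall i x, chart_dom i x -> @chart_act i 1%g x = x;
  act_mul : forall i g h x, chart_dom i x ->
    @chart_act i (g * h)%g x = @chart_act i g (@chart_act i h x);
  act_smooth : forall i g, smooth_on (chart_dom i) (@chart_act i g);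
  act_effective : forall i g,
    (forall x, chart_dom i x -> @chart_act i g x = x) -> g = 1%g;
  proj_cont : forall i x, chart_dom i x -> {for x, continuous (chart_proj i)};
  (* the next two say that V/G -> X is injective and open *)
  proj_orbit : forall i x y, chart_dom i x -> chart_dom i y ->
    chart_proj i x = chart_proj i y <-> exists g, y = @chart_act i g x;
  proj_open : forall i U, open U -> U `<=` chart_dom i -> open (chart_proj i @` U);
  proj_cover : forall p, exists i x, chart_dom i x /\ chart_proj i x = p }.

Record embedding n X (A : atlas n X) (i j : chart A) := Embedding {
  emb_fun :> E n -> E n;
  emb_hom : chart_grp i -> chart_grp j;
  emb_homM : forall g h, emb_hom (g * h)%g = (emb_hom g * emb_hom h)%g;
  emb_dom : forall x, chart_dom i x -> chart_dom j (emb_fun x);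
  emb_smooth : smooth_on (chart_dom i) emb_fun;
  emb_open : open (emb_fun @` chart_dom i);
  emb_inv : exists f : E n -> E n, smooth_on (emb_fun @` chart_dom i) f /\
    forall x, chart_dom i x -> f (emb_fun x) = x;
  emb_equiv : forall g x, chart_dom i x ->
    emb_fun (chart_act g x) = chart_act (emb_hom g) (emb_fun x);
  emb_proj : forall x, chart_dom i x -> chart_proj j (emb_fun x) = chart_proj i x }.

Section ActionEmbedding.
Variables (n : nat) (X : topologicalType) (A : atlas n X).
Variables (i : chart A) (g : chart_grp i).

Let conj_hom (h : chart_grp i) : chart_grp i := (g * h * g^-1)%g.

Fact act_homM h k : conj_hom (h * k)%g = (conj_hom h * conj_hom k)%g.
Proof. by rewrite /conj_hom !mulgA mulgKV. Qed.

Fact act_image : chart_act g @` chart_dom i = chart_dom i.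
Proof.
apply/seteqP; split => [_ [x Vx <-]|x Vx]; first exact: act_dom.
exists (chart_act (g^-1)%g x); first exact: act_dom.
by rewrite -act_mul // mulgV act_one.
Qed.

Fact act_open : open (chart_act g @` chart_dom i).
Proof. by rewrite act_image; exact: dom_open. Qed.

Fact act_inv : exists f : E n -> E n, smooth_on (chart_act g @` chart_dom i) f /\
  forall x, chart_dom i x -> f (chart_act g x) = x.
Proof.
exists (chart_act (g^-1)%g); split; first by rewrite act_image; exact: act_smooth.
by move=> x Vx; rewrite -act_mul // mulVg act_one.
Qed.

Fact act_equiv h x : chart_dom i x -> chart_act g (chart_act h x) = chart_act (conj_hom h) (chart_act g x).
Proof. by move=> Vx; rewrite -!act_mul // /conj_hom mulgKV. Qed.

Fact act_proj x : chart_dom i x -> chart_proj i (chart_act g x) = chart_proj i x.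
Proof.
by move=> Vx; apply/esym/proj_orbit => //; [exact: act_dom|exists g].
Qed.

(* Local group elements are particular embeddings of a chart into itself. *)
Definition act_emb : embedding i i :=
  Embedding act_homM (@act_dom _ _ A i g) (@act_smooth _ _ A i g)
    act_open act_inv act_equiv act_proj.

End ActionEmbedding.

Record orbifold (n : nat) (X : topologicalType) := Orbifold {
  orb_atlas :> atlas n X;
  orb_hausdorff : hausdorff_space X;
  orb_paracompact : paracompact X;
  orb_compatible : forall (i j : chart orb_atlas) x y,
    chart_dom i x -> chart_dom j y -> chart_proj i x = chart_proj j y ->
    exists k z (l : embedding k i) (m : embedding k j),
      [/\ chart_dom k z, l z = x & m z = y] }.

Definition bilin m (S : 'M[R]_m) (u v : 'cV[R]_m) : R := (u^T *m S *m v) 0 0.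

Record symplectic_form n X (O : orbifold n X) := SymplecticForm {
  sform : forall i : chart O, E n -> 'M[R]_(2 * n);
  sform_smooth : forall i, smooth_on (chart_dom i) (sform i);
  sform_skew : forall i x, chart_dom i x -> (sform i x)^T = - sform i x;
  sform_nondegenerate : forall i x, chart_dom i x -> sform i x \in unitmx;
  sform_closed : forall i x u v w, chart_dom i x ->
    'D_u (fun y => bilin (sform i y) v w : R^o) x
    + 'D_v (fun y => bilin (sform i y) w u : R^o) x
    + 'D_w (fun y => bilin (sform i y) u v : R^o) x = 0;
  sform_pullback : forall i j (l : embedding i j) x u v, chart_dom i x ->
    bilin (sform j (l x)) ('D_u l x) ('D_v l x) = bilin (sform i x) u v }.

(* P x is the fibre at x of a real polarization on the open set U, as a set of
   complex tangent vectors. *)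
Record is_real_polarization n (U : set (E n)) (S : E n -> 'M[R]_(2 * n))
    (P : E n -> set 'cV[R[i]]_(2 * n)) : Prop := IsRealPolarization {
  pol_subbundle : forall x, U x ->
    exists W (Z : E n -> 'M[R[i]]_(2 * n, n)),
      [/\ open W, W x, mxsmooth_on W Z &
        forall y, U y -> W y ->
          \rank (Z y) = n /\ forall v, P y v <-> exists c, v = Z y *m c];
  pol_lagrangian : forall x u v, U x -> P x u -> P x v ->
    u^T *m cpx (S x) *m v = 0;
  pol_involutive : forall W (Y Z : E n -> 'cV[R[i]]_(2 * n)),
    open W -> W `<=` U -> mxsmooth_on W Y -> mxsmooth_on W Z ->
    (forall x, W x -> P x (Y x)) -> (forall x, W x -> P x (Z x)) ->
    forall x, W x -> P x (dCm Z x (Y x) - dCm Y x (Z x));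
  pol_real : forall x v, U x -> P x v -> P x (mxconj v) }.

Record real_polarization n X (O : orbifold n X) (om : symplectic_form O) :=
  RealPolarization {
  pol :> forall i : chart O, E n -> set 'cV[R[i]]_(2 * n);
  pol_chart : forall i, is_real_polarization (chart_dom i) (sform om i) (pol i);
  pol_equiv : forall i j (l : embedding i j) x v, chart_dom i x ->
    pol i x v <-> pol j (l x) (tangent_map l x v) }.

(* A line bundle on each chart is given by its fibres and an atlas of smooth
   local frames.  The lifts of chart embeddings contain, through [act_emb], the
   lifted actions of the local groups; [lift_comp] then contains both the
   action law and the equivariance of the lifts of embeddings. *)
Record line_bundle n X (O : orbifold n X) := LineBundle {
  fib : forall i : chart O, E n -> lmodType R[i];
  fib_line : forall i x, chart_dom i x ->
    exists2 e : fib i x, e != 0 & forall a, exists c, a = c *: e;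
  frame : forall i : chart O, set (E n) -> (forall x, fib i x) -> Prop;
  frame_open : forall i U e, @frame i U e -> open U /\ U `<=` chart_dom i;
  frame_neq0 : forall i U e x, @frame i U e -> U x -> e x != 0;
  frame_cover : forall i x, chart_dom i x -> exists U e, @frame i U e /\ U x;
  frame_trans : forall i U e U' e', @frame i U e -> @frame i U' e' ->
    exists2 f, csmooth_on (U `&` U') f &
      forall x, U x -> U' x -> e' x = f x *: e x;
  fib_lift : forall i j (l : embedding i j) x, fib i x -> fib j (l x);
  lift_linear : forall i j (l : embedding i j) x c a b, chart_dom i x ->
    @fib_lift i j l x (c *: a + b) = c *: @fib_lift i j l x a + @fib_lift i j l x b;
  lift_inj : forall i j (l : embedding i j) x, chart_dom i x ->
    injective (@fib_lift i j l x);
  lift_smooth : forall i j (l : embedding i j) U e U' e',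
    @frame i U e -> @frame j U' e' ->
    exists2 f, csmooth_on (U `&` (l @^-1` U')) f &
      forall x, U x -> U' (l x) -> @fib_lift i j l x (e x) = f x *: e' (l x);
  lift_comp : forall i j j' k (l1 : embedding i j) (l2 : embedding j k)
    (m1 : embedding i j') (m2 : embedding j' k),
    (forall y, chart_dom i y -> l2 (l1 y) = m2 (m1 y)) ->
    forall x (a : fib i x), chart_dom i x ->
      existT (fib k) (l2 (l1 x)) (@fib_lift j k l2 _ (@fib_lift i j l1 x a))
      = existT (fib k) (m2 (m1 x)) (@fib_lift j' k m2 _ (@fib_lift i j' m1 x a));
  lift_id : forall i (l : embedding i i), (forall y, chart_dom i y -> l y = y) ->
    forall x (a : fib i x), chart_dom i x ->
      existT (fib i) (l x) (@fib_lift i i l x a) = existT (fib i) x a }.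

Definition section_on n X (O : orbifold n X) (B : line_bundle O) (i : chart O) :=
  forall x, fib B i x.

Definition smooth_section n X (O : orbifold n X) (B : line_bundle O)
    (i : chart O) (U : set (E n)) (s : section_on B i) : Prop :=
  [/\ open U, U `<=` chart_dom i &
    forall W e, @frame _ _ _ B i W e ->
      exists2 f, csmooth_on (U `&` W) f &
        forall x, U x -> W x -> s x = f x *: e x].

(* A connection differentiating only along the distribution D; [nabla s v] is
   the section x |-> (nabla_v s)(x), meaningful where s is smooth. *)
Record is_partial_connection n X (O : orbifold n X) (B : line_bundle O)
    (D : forall i : chart O, E n -> set (E n))
    (nabla : forall i, section_on B i -> E n -> section_on B i)
    : Prop := IsPartialConnection {
  conn_local : forall i U (s s' : section_on B i) x v,
    smooth_section U s -> (forall y, U y -> s y = s' y) ->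
    U x -> D i x v -> nabla i s v x = nabla i s' v x;
  conn_add : forall i U (s s' : section_on B i) x v,
    smooth_section U s -> smooth_section U s' -> U x -> D i x v ->
    nabla i (fun y => s y + s' y) v x = nabla i s v x + nabla i s' v x;
  conn_leibniz : forall i U (s : section_on B i) f x v,
    smooth_section U s -> csmooth_on U f -> U x -> D i x v ->
    nabla i (fun y => f y *: s y) v x
    = dC f x v *: s x + f x *: nabla i s v x;
  conn_linear : forall i U (s : section_on B i) x c u v,
    smooth_section U s -> U x -> D i x u -> D i x v ->
    nabla i s (c *: u + v) x = c%:C *: nabla i s u x + nabla i s v x;
  conn_smooth : forall i U (s : section_on B i) (Y : E n -> E n),
    smooth_section U s -> smooth_on U Y -> (forall x, U x -> D i x (Y x)) ->
    smooth_section U (fun x => nabla i s (Y x) x) }.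

Record prequantum_bundle n X (O : orbifold n X) (om : symplectic_form O)
    (hbar : R) := PrequantumBundle {
  pq_bundle :> line_bundle O;
  herm : forall i x, fib pq_bundle i x -> fib pq_bundle i x -> R[i];
  herm_linear : forall i x c a b d, chart_dom i x ->
    @herm i x (c *: a + b) d = c * @herm i x a d + @herm i x b d;
  herm_conj : forall i x a b, chart_dom i x -> @herm i x b a = (@herm i x a b)^*;
  herm_pos : forall i x a, chart_dom i x -> a != 0 -> 0 < @herm i x a a;
  herm_smooth : forall i U e, @frame _ _ _ pq_bundle i U e ->
    csmooth_on U (fun x => @herm i x (e x) (e x));
  herm_lift : forall i j (l : embedding i j) x a b, chart_dom i x ->
    @herm j (l x) (fib_lift l a) (fib_lift l b) = @herm i x a b;
  pq_conn : forall i, section_on pq_bundle i -> E n -> section_on pq_bundle i;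
  pq_connP : is_partial_connection (fun _ _ => setT) pq_conn;
  pq_conn_lift : forall i j (l : embedding i j) U W
    (s : section_on pq_bundle i) (s' : section_on pq_bundle j),
    smooth_section U s -> smooth_section W s' -> (forall x, U x -> W (l x)) ->
    (forall x, U x -> fib_lift l (s x) = s' (l x)) ->
    forall x v, U x -> fib_lift l (@pq_conn i s v x) = @pq_conn j s' ('D_v l x) (l x);
  pq_unitary : forall i U (s s' : section_on pq_bundle i) x v,
    smooth_section U s -> smooth_section U s' -> U x ->
    dC (fun y => @herm i y (s y) (s' y)) x v
    = @herm i x (@pq_conn i s v x) (s' x) + @herm i x (s x) (@pq_conn i s' v x);
  pq_curvature : forall i U (s : section_on pq_bundle i) x u v,
    smooth_section U s -> U x ->
    @pq_conn i (@pq_conn i s v) u x - @pq_conn i (@pq_conn i s u) v x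
    = Complex 0 (- (bilin (sform om i x) u v / hbar)) *: s x }.

Section HalfForm.
Variables (n : nat) (X : topologicalType) (O : orbifold n X).
Variables (om : symplectic_form O) (P : real_polarization om).

Definition realpol (i : chart O) (x : E n) : set (E n) :=
  [set v | P i x (cpx v)].

(* A complex n-covector at x is a function of the n vectors which are the
   columns of a matrix.  Elements of K_P = \bigwedge^n P^o are the multiples of
   the wedge products of n covectors (the rows of a) which annihilate P. *)
Definition KP (i : chart O) (x : E n) : set ('M[R[i]]_(2 * n, n) -> R[i]) :=
  [set k | exists c (a : 'M[R[i]]_(n, 2 * n)),
    (forall v, P i x v -> a *m v = 0) /\ forall W, k W = c * \det (a *m W)].

Definition set_col m p (W : 'M[R[i]]_(m, p)) (j : 'I_p) (v : 'cV[R[i]]_m)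
    : 'M[R[i]]_(m, p) :=
  \matrix_(r, s) if s == j then v r 0 else W r s.

(* Lie derivative of a local section k of K_P along v in P: as k is killed by
   contraction with P, it is the contraction of d k with v. *)
Definition lie_derivative (k : E n -> 'M[R[i]]_(2 * n, n) -> R[i])
    (x v : E n) (W : 'M[R[i]]_(2 * n, n)) : R[i] :=
  dC (fun y => k y W) x v
  - \sum_j dCC (fun y => k y (set_col W j (cpx v))) x (col j W).

(* [hf_sq] is the isomorphism from the square of delta_P to K_P, given as a
   nondegenerate bilinear map on the lines delta_P x delta_P. *)
Record half_form_bundle := HalfFormBundle {
  hf_bundle :> line_bundle O;
  hf_sq : forall i x, fib hf_bundle i x -> fib hf_bundle i x ->
    'M[R[i]]_(2 * n, n) -> R[i];
  hf_sq_KP : forall i x a b, chart_dom i x -> KP i x (@hf_sq i x a b);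
  hf_sq_linearl : forall i x c a b d W, chart_dom i x ->
    @hf_sq i x (c *: a + b) d W = c * @hf_sq i x a d W + @hf_sq i x b d W;
  hf_sq_linearr : forall i x c a b d W, chart_dom i x ->
    @hf_sq i x d (c *: a + b) W = c * @hf_sq i x d a W + @hf_sq i x d b W;
  hf_sq_neq0 : forall i x a b, chart_dom i x -> a != 0 -> b != 0 ->
    exists W, @hf_sq i x a b W != 0;
  hf_sq_smooth : forall i U e W, @frame _ _ _ hf_bundle i U e ->
    csmooth_on U (fun x => @hf_sq i x (e x) (e x) W);
  hf_sq_lift : forall i j (l : embedding i j) x a b W, chart_dom i x ->
    @hf_sq j (l x) (fib_lift l a) (fib_lift l b) (tangent_map l x W) = @hf_sq i x a b W;
  hf_conn : forall i, section_on hf_bundle i -> E n -> section_on hf_bundle i;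
  hf_connP : is_partial_connection realpol hf_conn;
  hf_conn_lie : forall i U (s : section_on hf_bundle i) x v W,
    smooth_section U s -> U x -> realpol i x v ->
    @hf_sq i x (@hf_conn i s v x) (s x) W + @hf_sq i x (s x) (@hf_conn i s v x) W
    = lie_derivative (fun y => @hf_sq i y (s y) (s y)) x v W }.

End HalfForm.

Section Leaf.
Variables (n : nat) (X : topologicalType) (O : orbifold n X).
Variables (om : symplectic_form O) (P : real_polarization om).

Definition I01 : set R := [set t | 0 <= t <= 1].

Notation velocity g t := ('D_(1 : R^o) (g : R^o -> E n) t).

(* A smooth path in a lifted leaf is a smooth path tangent to P; only its
   restriction to [0, 1] matters. *)
Definition leaf_path (i : chart O) (g : R -> E n) : Prop :=
  (exists U : set R^o, [/\ open U, I01 `<=` U &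
                           smooth_on U (g : R^o -> E n)]) /\
  (forall t, I01 t -> chart_dom i (g t) /\ realpol P i (g t) (velocity g t)).

Definition restrict_path (g : R -> E n) (a b t : R) : E n :=
  g (a + t * (b - a)).

(* Homotopy with fixed endpoints inside a lifted leaf. *)
Definition leaf_homotopic (i : chart O) (g g' : R -> E n) : Prop :=
  exists (U : set (R^o * R^o)%type) (H : (R^o * R^o)%type -> E n),
    [/\ open U, (forall s t, I01 s -> I01 t -> U (s, t)),
        smooth_on U H,
        (forall s t, I01 s -> I01 t ->
           [/\ chart_dom i (H (s, t)),
               realpol P i (H (s, t)) ('D_((1, 0) : (R^o * R^o)%type) H (s, t)) &
               realpol P i (H (s, t)) ('D_((0, 1) : (R^o * R^o)%type) H (s, t))]) &
        (forall t, I01 t ->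
           [/\ H (0, t) = g t, H (1, t) = g' t, H (t, 0) = g 0 & H (t, 1) = g 1])].

Definition chart_point : Type := (chart O * E n)%type.
Definition in_dom (p : chart_point) : Prop := chart_dom p.1 p.2.
Definition pt_image (p : chart_point) : X := chart_proj p.1 p.2.

Inductive arrow : Type :=
  | Seg (i : chart O) (g : R -> E n)
  | Jump (i j : chart O) (l : embedding i j) (x : E n).

Definition asrc (a : arrow) : chart_point :=
  match a with Seg i g => (i, g 0) | @Jump i j l x => (i, x) end.
Definition atgt (a : arrow) : chart_point :=
  match a with Seg i g => (i, g 1) | @Jump i j l x => (j, l x) end.
Definition arrow_ok (a : arrow) : Prop :=
  match a with Seg i g => leaf_path i g | @Jump i j l x => chart_dom i x end.

(* Orbifold paths are sequences of segments and chart changes; the letter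
   (a, true) is a traversed backwards. *)
Definition letter : Type := (arrow * bool)%type.
Definition lsrc (a : letter) := if a.2 then atgt a.1 else asrc a.1.
Definition ltgt (a : letter) := if a.2 then asrc a.1 else atgt a.1.
Definition linv (a : letter) : letter := (a.1, ~~ a.2).
Definition fwd (a : arrow) : letter := (a, false).

Fixpoint orbipath (p : chart_point) (w : seq letter) (q : chart_point) : Prop :=
  match w with
  | [::] => p = q
  | a :: w' => [/\ arrow_ok a.1, lsrc a = p & orbipath (ltgt a) w' q]
  end.

Definition winv (w : seq letter) : seq letter := rev (map linv w).

Definition chart_change (a : letter) : bool :=
  if a.1 is Seg _ _ then false else true.

(* A leaf is the set of points reached from one of them by gluing lifted leaf
   segments along chart embeddings (and local group elements). *)
Definition is_leaf (Lf : set X) : Prop :=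
  exists p, in_dom p /\
    Lf = [set y | exists w q, orbipath p w q /\ pt_image q = y].

Inductive move : seq letter -> seq letter -> Prop :=
  | move_homotopy i g g' : leaf_homotopic i g g' ->
      move [:: fwd (Seg i g)] [:: fwd (Seg i g')]
  | move_split i g c : I01 c ->
      move [:: fwd (Seg i g)]
           [:: fwd (Seg i (restrict_path g 0 c)); fwd (Seg i (restrict_path g c 1))]
  | move_const i g : (forall t, I01 t -> g t = g 0) ->
      move [:: fwd (Seg i g)] [::]
  | move_inv a : move [:: a; linv a] [::]
  | move_natural i j (l : embedding i j) g :
      move [:: fwd (Seg i g); fwd (Jump l (g 1))]
           [:: fwd (Jump l (g 0)); fwd (Seg j (fun t => l (g t)))]
  | move_comp i j j' k (l1 : embedding i j) (l2 : embedding j k)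
      (m1 : embedding i j') (m2 : embedding j' k) x :
      (forall y, chart_dom i y -> l2 (l1 y) = m2 (m1 y)) ->
      move [:: fwd (Jump l1 x); fwd (Jump l2 (l1 x))]
           [:: fwd (Jump m1 x); fwd (Jump m2 (m1 x))]
  | move_id i (l : embedding i i) x : (forall y, chart_dom i y -> l y = y) ->
      move [:: fwd (Jump l x)] [::].

Inductive homotopic (p q : chart_point) : seq letter -> seq letter -> Prop :=
  | homotopic_refl w : orbipath p w q -> homotopic p q w w
  | homotopic_sym w w' : homotopic p q w w' -> homotopic p q w' w
  | homotopic_trans w w' w'' :
      homotopic p q w w' -> homotopic p q w' w'' -> homotopic p q w w''
  | homotopic_move u s s' v : move s s' ->
      orbipath p (u ++ s ++ v) q -> orbipath p (u ++ s' ++ v) q ->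
      homotopic p q (u ++ s ++ v) (u ++ s' ++ v).

Lemma orbipath_cat p q r u v :
  orbipath p u q -> orbipath q v r -> orbipath p (u ++ v) r.
Proof.
elim: u p => [p /= <- //|a u IH p /= [aok sa ua] vr].
by split => //; exact: IH.
Qed.

Lemma orbipath_catP p r u v : orbipath p (u ++ v) r ->
  exists2 q, orbipath p u q & orbipath q v r.
Proof.
elim: u p => [p /= h|a u IH p /= [aok sa h]]; first by exists p.
by have [q uq qv] := IH _ h; exists q.
Qed.

Lemma linvK : involutive linv. Proof. by move=> [a b]; rewrite /linv /= negbK. Qed.
Lemma lsrc_inv a : lsrc (linv a) = ltgt a. Proof. by case: a => a []. Qed.
Lemma ltgt_inv a : ltgt (linv a) = lsrc a. Proof. by case: a => a []. Qed.

Lemma winvK : involutive winv.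
Proof. by move=> w; rewrite /winv map_rev revK mapK //; exact: linvK. Qed.

Lemma orbipath_winv p q w : orbipath p w q -> orbipath q (winv w) p.
Proof.
elim: w p => [p /= -> //|a w IH p /= [aok sa h]].
rewrite /winv /= rev_cons -cats1; apply: orbipath_cat (IH _ h) _ => /=.
by rewrite lsrc_inv ltgt_inv sa.
Qed.

Lemma homotopic_orbipath p q w w' : homotopic p q w w' ->
  orbipath p w q /\ orbipath p w' q.
Proof.
by elim=> {w w'} [w|w w' _ []|w w' w'' _ [? _] _ [_ ?]|]; split.
Qed.

Lemma homotopic_catl p q r u v v' : orbipath p u q ->
  homotopic q r v v' -> homotopic p r (u ++ v) (u ++ v').
Proof.
move=> pu; elim=> {v v'} [w h|w w' _ h|w w' w'' _ h _ h'|x s s' v m h h'].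
- by apply: homotopic_refl; exact: orbipath_cat h.
- exact: homotopic_sym.
- exact: homotopic_trans h h'.
- rewrite (catA u x (s ++ v)) (catA u x (s' ++ v)).
  by apply: homotopic_move => //; rewrite -catA; exact: orbipath_cat pu _.
Qed.

Lemma homotopic_catr p q r u u' v : orbipath q v r ->
  homotopic p q u u' -> homotopic p r (u ++ v) (u' ++ v).
Proof.
move=> qv; elim=> {u u'} [w h|w w' _ h|w w' w'' _ h _ h'|x s s' y m h h'].
- by apply: homotopic_refl; exact: orbipath_cat qv.
- exact: homotopic_sym.
- exact: homotopic_trans h h'.
- have e z : (x ++ z ++ y) ++ v = x ++ z ++ (y ++ v) by rewrite -!catA.
  by rewrite !e; apply: homotopic_move => //; rewrite -e; exact: orbipath_cat qv.
Qed.

Lemma homotopic_cat p q r u u' v v' :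
  homotopic p q u u' -> homotopic q r v v' ->
  homotopic p r (u ++ v) (u' ++ v').
Proof.
move=> hu hv; have [pu pu'] := homotopic_orbipath hu.
have [qv _] := homotopic_orbipath hv.
exact: homotopic_trans (homotopic_catr qv hu) (homotopic_catl pu' hv).
Qed.

Lemma homotopic_mulV p q w : orbipath p w q ->
  homotopic p p (w ++ winv w) [::].
Proof.
elim: w p => [p /= _|a w IH p pw]; first exact: homotopic_refl.
have pwV := orbipath_cat pw (orbipath_winv pw).
case: (pw) => aok sa wq.
have hw := IH _ wq.
have aa : orbipath p ([::] ++ [:: a; linv a] ++ [::]) p.
  by split=> //; split=> //; rewrite ?lsrc_inv // ltgt_inv.
have e : (a :: w) ++ winv (a :: w) = [:: a] ++ (w ++ winv w) ++ [:: linv a].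
  by rewrite /winv /= rev_cons -cats1 -!catA.
rewrite e; apply: (@homotopic_trans _ _ _ ([:: a] ++ [::] ++ [:: linv a])).
  apply: (@homotopic_catl p (ltgt a)); first by split.
  apply: (@homotopic_catr (ltgt a) (ltgt a)) => //=.
  by split=> //; [rewrite lsrc_inv|rewrite ltgt_inv].
exact: (@homotopic_move p p [::] [:: a; linv a] [::] [::] (move_inv a) aa erefl).
Qed.

Lemma homotopic_mulVr p q w : orbipath p w q ->
  homotopic q q (winv w ++ w) [::].
Proof.
move=> /orbipath_winv h; rewrite -{2}(winvK w); exact: homotopic_mulV h.
Qed.

Lemma homotopic_winv p q w w' : homotopic p q w w' ->
  homotopic q p (winv w) (winv w').
Proof.
move=> h; have [pw pw'] := homotopic_orbipath h.
have qw := orbipath_winv pw; have qw' := orbipath_winv pw'.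
have h1 : homotopic q p (winv w) (winv w ++ w' ++ winv w').
  rewrite -[X in homotopic _ _ X _]cats0.
  apply: (homotopic_catl qw); apply: homotopic_sym; exact: homotopic_mulV pw'.
apply: (homotopic_trans h1).
rewrite catA -[X in homotopic _ _ _ X]cat0s.
apply: (homotopic_catr qw').
apply: homotopic_trans (homotopic_mulVr pw).
apply: (homotopic_catl qw); exact: homotopic_sym.
Qed.

Variable p0 : chart_point.

Record loop : Type := Loop {
  loop_word :> seq letter;
  loopP : orbipath p0 loop_word p0 }.

HB.instance Definition _ := gen_eqMixin loop.
HB.instance Definition _ := gen_choiceMixin loop.

Definition loop_rel (u v : loop) : bool := `[< homotopic p0 p0 u v >].

Fact loop_rel_refl : reflexive loop_rel.
Proof. by move=> w; apply/asboolP/homotopic_refl/loopP. Qed.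
Fact loop_rel_sym : symmetric loop_rel.
Proof. by move=> u v; apply/asboolP/asboolP => /homotopic_sym. Qed.
Fact loop_rel_trans : transitive loop_rel.
Proof.
by move=> v u w /asboolP uv /asboolP vw; apply/asboolP/(homotopic_trans uv vw).
Qed.

Canonical loop_equiv :=
  EquivRel loop_rel loop_rel_refl loop_rel_sym loop_rel_trans.

Definition pi1 : Type := {eq_quot loop_equiv}%qT.
HB.instance Definition _ := Choice.on pi1.

Definition loop_class (w : loop) : pi1 := (\pi_{eq_quot loop_equiv} w)%qT.

Lemma loop_classP u v : loop_class u = loop_class v <-> homotopic p0 p0 u v.
Proof.
rewrite /loop_class; split=> [/eqquotP|h]; first by move=> /asboolP.
by apply/eqquotP/asboolP.
Qed.

Definition loop_one : loop := @Loop [::] erefl.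
Definition loop_mul (u v : loop) : loop := Loop (orbipath_cat (loopP u) (loopP v)).
Definition loop_inv (u : loop) : loop := Loop (orbipath_winv (loopP u)).

Definition pi1_repr (c : pi1) : loop := repr (c : {eq_quot loop_equiv}%qT).
Lemma pi1_reprK c : loop_class (pi1_repr c) = c.
Proof. exact: reprK. Qed.

Definition pi1_mul (c d : pi1) : pi1 :=
  loop_class (loop_mul (pi1_repr c) (pi1_repr d)).
Definition pi1_inv (c : pi1) : pi1 := loop_class (loop_inv (pi1_repr c)).

Lemma pi1_mulE u v :
  pi1_mul (loop_class u) (loop_class v) = loop_class (loop_mul u v).
Proof. by apply/loop_classP/homotopic_cat; apply/loop_classP/pi1_reprK. Qed.

Lemma pi1_invE u : pi1_inv (loop_class u) = loop_class (loop_inv u).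
Proof. by apply/loop_classP/homotopic_winv/loop_classP/pi1_reprK. Qed.

Fact pi1_mulA : associative pi1_mul.
Proof.
move=> a b c; rewrite -(pi1_reprK a) -(pi1_reprK b) -(pi1_reprK c) !pi1_mulE.
apply/loop_classP; rewrite /= catA; apply: homotopic_refl.
exact: (loopP (loop_mul (loop_mul _ _) _)).
Qed.
Fact pi1_mul1 : left_id (loop_class loop_one) pi1_mul.
Proof.
move=> a; rewrite -(pi1_reprK a) pi1_mulE.
by apply/loop_classP/homotopic_refl/loopP.
Qed.
Fact pi1_1mul : right_id (loop_class loop_one) pi1_mul.
Proof.
move=> a; rewrite -(pi1_reprK a) pi1_mulE.
by apply/loop_classP; rewrite /= cats0; apply/homotopic_refl/loopP.
Qed.
Fact pi1_mulV : left_inverse (loop_class loop_one) pi1_inv pi1_mul.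
Proof.
move=> a; rewrite -(pi1_reprK a) pi1_invE pi1_mulE.
by apply/loop_classP/homotopic_mulVr/loopP.
Qed.
Fact pi1_Vmul : right_inverse (loop_class loop_one) pi1_inv pi1_mul.
Proof.
move=> a; rewrite -(pi1_reprK a) pi1_invE pi1_mulE.
by apply/loop_classP/homotopic_mulV/loopP.
Qed.

HB.instance Definition _ :=
  isGroup.Build pi1 pi1_mulA pi1_mul1 pi1_1mul pi1_mulV pi1_Vmul.

Definition generates (S : set pi1) : Prop :=
  forall H : set pi1, S `<=` H -> H 1%g ->
    (forall c d, H c -> H d -> H (c * d)%g) -> (forall c, H c -> H (c^-1)%g) ->
    forall c, H c.

End Leaf.

Arguments Seg {n X O} i g.
Arguments Jump {n X O i j} l x.

Section Maslov.
Variables (n : nat) (X : topologicalType) (O : orbifold n X).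
Variables (om : symplectic_form O) (P : real_polarization om).

(* Crossing of the Lagrangian subspaces P_{g(t)} with the tangent spaces Q of
   the fibres of a reference Lagrangian fibration, along a path g.  If
   a(s) in P_{g(s)} and b(s) in Q_{g(s)} satisfy a(t) = b(t) = v then the
   crossing form at t is (u, v) |-> om(u, a'(t) - b'(t)).  For Q the vertical
   polarization of T^*M and om = dp /\ dq this is <p(u), (dq o a)'(t)>, so that
   the clockwise unit circle of the (q, p)-plane has index 2. *)
Definition crossing_form (i : chart O) (Q : E n -> set 'cV[R[i]]_(2 * n))
    (g : R -> E n) (t : R) (u v : E n) (c : R) : Prop :=
  exists (U : set R^o) (a b : R^o -> E n),
    [/\ open U, U t, smooth_on U a & smooth_on U b] /\
    [/\ a t = v, b t = v,
        (forall s, U s -> realpol P i (g s) (a s) /\ Q (g s) (cpx (b s))) &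
        c = bilin (sform om i (g t)) u ('D_(1 : R^o) a t - 'D_(1 : R^o) b t)].

Definition caustic (i : chart O) (Q : E n -> set 'cV[R[i]]_(2 * n)) (x : E n)
    : Prop :=
  exists v : E n, [/\ v != 0, realpol P i x v & Q x (cpx v)].

(* The crossing at t is regular, with crossing form of signature m. *)
Definition regular_crossing (i : chart O) (Q : E n -> set 'cV[R[i]]_(2 * n))
    (g : R -> E n) (t : R) (m : int) : Prop :=
  exists k (K : 'M[R]_(2 * n, k)) (sg : 'I_k -> bool),
    [/\ \rank K = k,
        (forall v, (realpol P i (g t) v /\ Q (g t) (cpx v)) <->
                   exists c, v = K *m c),
        (forall a b, crossing_form i Q g t (col a K) (col b K)
                       (if a == b then (-1) ^+ sg a else 0)) &
        m = \sum_a (-1) ^+ sg a].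

(* Caustics refer to a Lagrangian fibration (an involutive real Lagrangian
   distribution) defined near the lifted leaves of Lf.  The index of a path
   with finitely many caustic crossings, all regular and away from the
   endpoints, is the signed number of crossings; other paths are reached
   through homotopy invariance and additivity. *)
Record maslov_index (Lf : set X) := MaslovIndex {
  ref_dom : chart O -> set (E n);
  ref_pol : chart O -> E n -> set 'cV[R[i]]_(2 * n);
  ref_open : forall i, open (ref_dom i);
  ref_sub : forall i, ref_dom i `<=` chart_dom i;
  ref_leaf : forall i x, chart_dom i x -> Lf (chart_proj i x) -> ref_dom i x;
  ref_polP : forall i,
    is_real_polarization (ref_dom i) (sform om i) (ref_pol i);
  mas :> chart O -> (R -> E n) -> int;
  mas_homotopic : forall i g g', leaf_path P i g -> leaf_path P i g' ->
    Lf (chart_proj i (g 0)) -> leaf_homotopic P i g g' -> mas i g = mas i g';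
  mas_split : forall i g c, leaf_path P i g -> Lf (chart_proj i (g 0)) -> I01 c ->
    mas i g = mas i (restrict_path g 0 c) + mas i (restrict_path g c 1);
  mas_crossings : forall i g (ts : seq R) (m : R -> int),
    leaf_path P i g -> Lf (chart_proj i (g 0)) -> uniq ts ->
    (forall t, I01 t -> caustic i (ref_pol i) (g t) <-> t \in ts) ->
    (forall t, t \in ts -> 0 < t < 1 /\ regular_crossing i (ref_pol i) g t (m t)) ->
    mas i g = \sum_(t <- ts) m t }.

End Maslov.

(* t exhibits M as the tensor product of A and B. *)
Definition is_bilinear (K : comNzRingType) (A B M : lmodType K)
    (t : A -> B -> M) : Prop :=
  (forall c a a' b, t (c *: a + a') b = c *: t a b + t a' b) /\
  (forall c a b b', t a (c *: b + b') = c *: t a b + t a b').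

Definition is_tensor_product (K : comNzRingType) (A B M : lmodType K)
    (t : A -> B -> M) : Prop :=
  is_bilinear t /\
  forall (N : lmodType K) (f : A -> B -> N), is_bilinear f ->
    exists h : M -> N,
      [/\ linear h, forall a b, h (t a b) = f a b &
        forall h' : M -> N, linear h' -> (forall a b, h' (t a b) = f a b) ->
          h' =1 h].

Section Transport.
Variables (n : nat) (X : topologicalType) (O : orbifold n X).
Variables (om : symplectic_form O) (P : real_polarization om).

Notation velocity g t := ('D_(1 : R^o) (g : R^o -> E n) t).

Definition parallel (B : line_bundle O)
    (nabla : forall i, section_on B i -> E n -> section_on B i)
    (i : chart O) (g : R -> E n) (u : forall t, fib B i (g t)) : Prop :=
  forall t, I01 t -> forall U e, @frame _ _ _ B i U e -> U (g t) ->
    exists f : R^o -> R[i],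
      [/\ \forall s \near (t : R^o), I01 s -> u s = f s *: e (g s),
          derivable (fun s => complex.Re (f s) : R^o) t 1,
          derivable (fun s => complex.Im (f s) : R^o) t 1 &
          dC f t 1 *: e (g t) + f t *: nabla i e (velocity g t) (g t) = 0].

Variables (hbar : R) (L : prequantum_bundle om hbar).
Variables (delta : half_form_bundle P).
Variables (Lf : set X) (mu : maslov_index P Lf).
Variable M : forall i : chart O, E n -> lmodType R[i].
Variable ten : forall i x, fib L i x -> fib delta i x -> M i x.

Definition total : Type := {p : chart_point O & M p.1 p.2}.
Definition tot (p : chart_point O) (a : M p.1 p.2) : total :=
  existT (fun p : chart_point O => M p.1 p.2 : Type) p a.

(* Flat transport on L tensored with Maslov transport on delta_P, and the
   identifications of fibres under chart changes. *)
Inductive transport : arrow O -> total -> total -> Prop :=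
  | transport_seg i g (a : forall t, fib L i (g t))
      (b : forall t, fib delta i (g t)) :
      leaf_path P i g -> parallel (@pq_conn _ _ _ _ _ L) a ->
      parallel (@hf_conn _ _ _ _ _ delta) b ->
      transport (Seg i g)
        (@tot (i, g 0) (ten (a 0) (b 0)))
        (@tot (i, g 1) (ten (a 1)
           (cis (- (pi * (mu i g)%:~R / 2)) *: b 1)))
  | transport_jump i j (l : embedding i j) x (a : fib L i x)
      (b : fib delta i x) : chart_dom i x ->
      transport (Jump l x)
        (@tot (i, x) (ten a b)) (@tot (j, l x) (ten (fib_lift l a) (fib_lift l b))).

Fixpoint word_transport (w : seq (letter O)) (a b : total) : Prop :=
  match w with
  | [::] => a = b
  | l :: w' => exists c, (if l.2 then transport l.1 c a else transport l.1 a c)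
                         /\ word_transport w' c b
  end.

(* Corrected transport along lifted leaf segments commutes with the
   identifications induced by chart embeddings and local group elements. *)
Definition transport_compatible : Prop :=
  forall i j (l : embedding i j) g a b a' b',
    leaf_path P i g -> Lf (chart_proj i (g 0)) -> transport (Seg i g) a b ->
    transport (Jump l (g 0)) a a' -> transport (Jump l (g 1)) b b' ->
    transport (Seg j (fun t => l (g t))) a' b'.

Record is_corrected_holonomy (p0 : chart_point O) (Hol : pi1 P p0 -> R[i])
    : Prop := IsCorrectedHolonomy {
  hol_unitary : forall c, `|Hol c| = 1;
  hol_mul : forall c d, Hol (c * d)%g = Hol c * Hol d;
  hol_transport : forall (w : loop P p0) (a b : M p0.1 p0.2),
    word_transport w (tot a) (tot b) <-> b = Hol (loop_class w) *: a }.

Definition polarized_section (s : forall i x, M i x) : Prop :=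
  forall a, arrow_ok P a -> Lf (pt_image (asrc a)) ->
    transport a (tot (s (asrc a).1 (asrc a).2)) (tot (s (atgt a).1 (atgt a).2)).

Definition has_nonzero_polarized_section : Prop :=
  exists s, polarized_section s /\
    exists i x, [/\ chart_dom i x, Lf (chart_proj i x) & s i x != 0].

Definition symplectic_potential (i : chart O) (theta : E n -> 'rV[R]_(2 * n))
    : Prop :=
  smooth_on (chart_dom i) theta /\
  forall x u v, chart_dom i x ->
    'D_u (fun y => (theta y *m v) 0 0 : R^o) x
    - 'D_v (fun y => (theta y *m u) 0 0 : R^o) x = bilin (sform om i x) u v.

Definition invariant_form (i : chart O) (theta : E n -> 'rV[R]_(2 * n)) : Prop :=
  forall (g : chart_grp i) x v, chart_dom i x ->
    theta (chart_act g x) *m 'D_v (chart_act g) x = theta x *m v.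

Definition unitary_frame (i : chart O) (s0 : section_on L i) : Prop :=
  smooth_section (chart_dom i) s0 /\ forall x, chart_dom i x -> herm (s0 x) (s0 x) = 1.

(* nabla = d - (i/hbar) theta in the frame s0 *)
Definition connection_form (i : chart O) (s0 : section_on L i)
    (theta : E n -> 'rV[R]_(2 * n)) : Prop :=
  forall x v, chart_dom i x ->
    pq_conn s0 v x = Complex 0 (- ((theta x *m v) 0 0 / hbar)) *: s0 x.

Definition path_integral (theta : E n -> 'rV[R]_(2 * n)) (g : R -> E n) : R :=
  \int[lebesgue_measure]_(t in I01) ((theta (g t) *m velocity g t) 0 0).

End Transport.
End Orbifold.

Arguments chart_change {R n X O} a.
Arguments Seg {R n X O} i g.
Arguments Jump {R n X O i j} l x.

(* Main.v *)
Require Import Defs.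
Set Warnings "-notation-overridden,-ambiguous-paths,-notation-incompatible-prefix".
From mathcomp Require Import all_boot all_order all_algebra all_fingroup.
From mathcomp Require Import all_classical all_reals all_analysis.
From mathcomp Require Import complex ring lra.
Import Order.TTheory GRing.Theory Num.Theory.
Import numFieldNormedType.Exports.
Local Open Scope classical_set_scope.
Local Open Scope ring_scope.
Local Open Scope complex_scope.

Set Implicit Arguments.
Unset Strict Implicit.
Unset Printing Implicit Defensive.

(** Corrected transport is a relation on the one-dimensional fibres of
    [L \otimes delta_P] which is stable under scalars, and following a path from
    [p0] by its inverse gives a null-homotopic loop, whose transport is the
    identity by the holonomy hypothesis.  Hence transport along any path issued from [p0] is a linear
    bijection.  If the holonomy is trivial, transporting a fixed non-zero vector
    from [p0] does not depend on the path and gives a polarized section;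
    conversely a non-zero polarized section has a non-zero value at [p0], fixed
    by all loops.  For a loop inside a chart, [exp(i/hbar \int theta) s0] is
    parallel, so the holonomy is the product of the phases of the flat transport,
    the Maslov factor and the lifts of [g^-1] to [L] and [delta_P]. *)

(** * Linear algebra of lines and of their tensor products *)

Lemma existT_inj (T : Type) (F : T -> Type) (p : T) (a b : F p) :
  existT F p a = existT F p b -> a = b.
Proof.
(* Proof irrelevance turns the equality of first components into [erefl], so the cast in [projT2_eq]
   becomes the identity. *)
move=> e; have := projT2_eq e.
by rewrite (Prop_irrelevance (projT1_eq e) erefl).
Qed.

Lemma linear0P (K : pzRingType) (V W : lmodType K) (f : V -> W) :
  (forall c a b, f (c *: a + b) = c *: f a + f b) -> f 0 = 0.
Proof.
move=> fl; have /eqP := fl 1 0 0.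
rewrite !scale1r addr0 -{1}[f 0]addr0 (inj_eq (addrI _)) eq_sym.
by move/eqP.
Qed.

Lemma linearZP (K : pzRingType) (V W : lmodType K) (f : V -> W) :
  (forall c a b, f (c *: a + b) = c *: f a + f b) ->
  forall c a, f (c *: a) = c *: f a.
Proof. by move=> fl c a; rewrite -[c *: a]addr0 fl linear0P ?addr0. Qed.

Lemma bilinearZl (K : comNzRingType) (A B M : lmodType K) (t : A -> B -> M) :
  is_bilinear t -> forall c a b, t (c *: a) b = c *: t a b.
Proof. by move=> [tl _] c a b; apply: (linearZP (f := t^~ b)). Qed.

Lemma bilinearZr (K : comNzRingType) (A B M : lmodType K) (t : A -> B -> M) :
  is_bilinear t -> forall c a b, t a (c *: b) = c *: t a b.
Proof. by move=> [_ tr] c a b; apply: linearZP. Qed.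

Lemma line_span (K : fieldType) (V : lmodType K) (e f : V) :
  (forall a, exists c, a = c *: f) -> e != 0 -> forall a, exists c, a = c *: e.
Proof.
move=> fV e0 a; have [[c eE] [d ->]] := (fV e, fV a).
have c0 : c != 0 by apply: contraNneq e0 => c0; rewrite eE c0 scale0r.
by exists (d / c); rewrite eE scalerA divfK.
Qed.

(** Coefficients along a non-zero vector are unique, so the coordinate picked by choice is
    automatically linear. *)
Lemma line_coord (K : fieldType) (V : lmodType K) (e : V) :
  e != 0 -> (forall a, exists c, a = c *: e) ->
  exists f : V -> K^o, linear f /\ f e = 1.
Proof.
move=> e0 /choice[f fE].
have inj c d : c *: e = d *: e -> c = d.
  move=> /eqP; rewrite -subr_eq0 -scalerBl scaler_eq0 (negbTE e0) orbF subr_eq0.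
  by move/eqP.
exists f; split=> [c a b|]; apply: inj; last by rewrite -fE scale1r.
by rewrite scalerDl -scalerA -!fE.
Qed.

(** The product of the two coordinates is bilinear, hence factors through a linear [h] with
    [h (t e f) = 1]. This gives non-vanishing, and [h] is the coordinate along [t e f]. *)
Lemma tensor_of_lines (K : fieldType) (A B M : lmodType K) (t : A -> B -> M)
    (e : A) (f : B) : is_tensor_product t ->
  e != 0 -> (forall a, exists c, a = c *: e) ->
  f != 0 -> (forall b, exists c, b = c *: f) ->
  t e f != 0 /\ forall m, exists c, m = c *: t e f.
Proof.
move=> [tb tu] e0 eA f0 fB.
have [x [xl xe]] := line_coord e0 eA.
have [y [yl yf]] := line_coord f0 fB.
have xyb : is_bilinear (fun a b => x a * y b : K^o).
  split=> [c a a' b|c a b b'].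
    by rewrite xl mulrDl -scalerAl.
  by rewrite yl mulrDr -scalerAr.
have [h [hl ht _]] := tu _ _ xyb.
have htef : h (t e f) = 1 by rewrite ht xe yf mulr1.
split.
  apply/eqP => tef0; have := htef; rewrite tef0 (linear0P hl) => /eqP.
  by rewrite eq_sym oner_eq0.
(* By the uniqueness clause applied to [t] itself, the identity and [m |-> h m *: t e f] coincide,
   as both extend [t]. *)
have [k [_ _ ku]] := tu _ _ tb.
have idk := ku id (fun _ _ _ => erefl) (fun _ _ => erefl).
move=> m; exists (h m); rewrite [LHS]idk; apply/esym.
apply: (ku (fun m => h m *: t e f)) => [c a b|a b].
  by rewrite hl scalerDl scalerA.
rewrite ht.
have [[c ->] [d ->]] := (eA a, fB b).
rewrite (linearZP xl) (linearZP yl) xe yf (bilinearZl tb) (bilinearZr tb) scalerA.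
by rewrite [c *: 1]mulr1 [d *: 1]mulr1.
Qed.

(** * Derivatives of complex-valued functions of a real variable *)

Section ComplexDerivative.
Context {R : realType}.
Implicit Types (p q : R -> R[i]) (t : R).

Definition is_cderive p t (d : R[i]) : Prop :=
  is_derive t 1 (fun s => complex.Re (p s)) (complex.Re d) /\
  is_derive t 1 (fun s => complex.Im (p s)) (complex.Im d).

Lemma is_cderiveP (p : R^o -> R[i]) (t : R^o) d : is_cderive p t d <->
  [/\ derivable (fun s => complex.Re (p s) : R^o) t 1,
      derivable (fun s => complex.Im (p s) : R^o) t 1 & dC p t 1 = d].
Proof.
case: d => d e; split=> [[[dr re] [di im]]|[dr di [<- <-]]].
  by split=> //; congr Complex.
by split; apply: DeriveDef.
Qed.

Lemma is_cderive_cst (c : R[i]) t : is_cderive (cst c) t 0.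
Proof. by split; exact: is_derive_cst. Qed.

Lemma is_deriveMD (a b c d : R -> R) t a' b' c' d' :
  is_derive t 1 a a' -> is_derive t 1 b b' ->
  is_derive t 1 c c' -> is_derive t 1 d d' ->
  is_derive t 1 (fun s => a s * b s + c s * d s)
    (a t * b' + b t * a' + (c t * d' + d t * c')).
Proof. by move=> da db dc dd; exact: is_deriveD. Qed.

Lemma is_cderiveM p q t (p' q' : R[i]) :
  is_cderive p t p' -> is_cderive q t q' ->
  is_cderive (fun s => p s * q s) t (p' * q t + p t * q').
Proof.
move=> [pr pi] [qr qi]; split.
- have -> : (fun s => complex.Re (p s * q s)) = (fun s =>
      complex.Re (p s) * complex.Re (q s) + - complex.Im (p s) * complex.Im (q s)).
    by apply/funext => s; case: (p s) (q s) => [a b] [c d] /=; rewrite mulNr.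
  have npi : is_derive t 1 (fun s => - complex.Im (p s)) (- complex.Im p').
    exact: is_deriveN.
  have h := is_deriveMD pr qr npi qi.
  apply: (is_derive_eq h).
  by case: (p t) (q t) p' q' {h npi pr pi qr qi} => [a b] [c d] [x y] [z w] /=; ring.
- have -> : (fun s => complex.Im (p s * q s)) = (fun s =>
      complex.Re (p s) * complex.Im (q s) + complex.Im (p s) * complex.Re (q s)).
    by apply/funext => s; case: (p s) (q s) => [a b] [c d].
  have h := is_deriveMD pr qi pi qr.
  apply: (is_derive_eq h).
  by case: (p t) (q t) p' q' {h pr pi qr qi} => [a b] [c d] [x y] [z w] /=; ring.
Qed.

Lemma is_cderive_cis (F : R -> R) t d : is_derive t 1 F d ->
  is_cderive (fun s => cis (F s)) t (Complex 0 d * cis (F t)).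
Proof.
move=> Fd; split.
- have h := is_derive1_comp (is_derive_cos (F t)) Fd.
  by apply: (is_derive_eq h); rewrite /=; ring.
- have h := is_derive1_comp (is_derive_sin (F t)) Fd.
  by apply: (is_derive_eq h); rewrite /=; ring.
Qed.

End ComplexDerivative.

(** * Phases [cis] and primitives on the unit interval *)

Section Phase.
Context {R : realType}.

Lemma cisD (a b : R) : cis (a + b) = cis a * cis b.
Proof. by rewrite /cis cosD sinD; congr Complex; rewrite addrC. Qed.

Lemma cis0 : cis (0 : R) = 1.
Proof. by rewrite /cis cos0 sin0. Qed.

(** Subtracting a multiple of the period leaves an angle in [[0, 2 pi)] with sine 0 and cosine 1.
    The sine is non-zero on both open half-periods and the cosine is -1 at [pi], so the angle is
    0. *)
Lemma cis_eq1 (a : R) : cis a = 1 <-> exists m : int, a = 2 * pi * m%:~R.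
Proof.
have period (m : int) : cis (2 * pi * m%:~R) = 1 :> R[i].
  have pn k : cis (2 * pi * k%:R) = 1 :> R[i].
    elim: k => [|k IH]; first by rewrite mulr0 cis0.
    by rewrite -[k.+1%:R]natr1 mulrDr mulr1 cisD IH mul1r /cis mulr_natl cos2pi sin2pi.
  case: m => k; first exact: pn.
  rewrite NegzE; have := cisD (2 * pi * k.+1%:R) (2 * pi * (- k.+1%:Z)%:~R).
  by rewrite mulrNz mulrN addrN cis0 pn mul1r.
split=> [a1|[m ->]]; last exact: period.
have tpi : 0 < 2 * pi :> R by rewrite mulr_gt0 ?pi_gt0.
set m := Num.floor (a / (2 * pi)); exists m.
pose b := a - 2 * pi * m%:~R.
have b1 : cis b = 1.
  by have := cisD b (2 * pi * m%:~R); rewrite period mulr1 subrK a1.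
suff : b = 0 by move/eqP; rewrite subr_eq0 => /eqP.
have /andP[] := floor_itv (a / (2 * pi)).
rewrite -/m intrD ler_pdivlMr // ltr_pdivrMr // => m1 m2.
have b0 : 0 <= b by rewrite /b; lra.
have b2 : b < 2 * pi by rewrite /b; lra.
have cb : cos b = 1 :> R := congr1 (@complex.Re R) b1.
have sb : sin b = 0 :> R := congr1 (@complex.Im R) b1.
apply/eqP; rewrite eq_le b0 andbT leNgt; apply/negP => bp.
have [bpi|bpi|bpi] := ltgtP b pi.
- have : 0 < sin b by apply: sin_gt0_pi; rewrite bp.
  by rewrite sb ltxx.
- have : 0 < sin (b - pi) by apply: sin_gt0_pi; rewrite subr_gt0 bpi; lra.
  by rewrite sinB sb cospi sinpi mul0r mulr0 subrr ltxx.
- by move: cb; rewrite bpi cospi; lra.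
Qed.

Lemma primitive_unit_interval (h : R -> R) :
  (forall t, I01 t -> {for t, continuous h}) ->
  exists F : R -> R, [/\ F 0 = 0,
    F 1 = \int[lebesgue_measure]_(t in I01) h t &
    forall t, I01 t -> is_derive t 1 F (h t)].
Proof.
move=> hc.
(* Clamping the integrand makes the primitive differentiable on both sides of
   the endpoints. *)
pose clamp (t : R) : R := (`|t| - `|t - 1| + 1) / 2.
have clampI t : I01 (clamp t).
  by rewrite /I01 /= /clamp; case: (ger0P t); case: (ger0P (t - 1)); lra.
have clampE t : I01 t -> clamp t = t.
  by rewrite /I01 /= /clamp; case: (ger0P t); case: (ger0P (t - 1)); lra.
have clampC : continuous clamp.
  move=> t; apply: cvgM; last exact: cvg_cst.
  apply: cvgD; last exact: cvg_cst.
  apply: cvgB; first by apply: cvg_norm; exact: cvg_id.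
  by apply: cvg_norm; apply: cvgB; [exact: cvg_id|exact: cvg_cst].
pose k := h \o clamp.
have kC : continuous k by move=> t; apply: continuous_comp; [exact: clampC|exact: hc].
(* Starting at -1, and applying the fundamental theorem up to 2, makes 0 and 1 interior points. *)
pose G x := \int[lebesgue_measure]_(t in `[-1, x]) k t.
have kI x : lebesgue_measure.-integrable `[-1, x] (EFin \o k).
  apply: continuous_compact_integrable; first exact: segment_compact.
  exact: continuous_subspaceT.
have GD t : I01 t -> is_derive t 1 G (h t).
  move=> It; have /andP[t0 t1] := It.
  have [] := @continuous_FTC1_closed _ k (-1) t 2 _ (kI 2) _ (kC t); [lra..|].
  by move=> dG eG; apply: DeriveDef => //; rewrite -derive1E eG /k /= clampE.
exists (fun x => G x - G 0); split; first by rewrite subrr.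
- rewrite /G Rintegral_itvB ?bnd_simp //.
  have I01E : I01 = `[0, 1]%classic :> set R by rewrite set_itvcc.
  rewrite Rintegral_itv_obnd_cbnd ?I01E; last first.
    apply: integrableS (kI 1) => //; apply: subset_itvr.
    by rewrite bnd_simp; lra.
  apply: eq_Rintegral => t; rewrite inE -I01E => It.
  by rewrite /k /= clampE.
- move=> t It; have := is_deriveB (GD t It) (is_derive_cst (G 0) t 1).
  by rewrite subr0.
Qed.

End Phase.

(** * Frames, lifts of local group elements, and flat transport on [L] *)

Section Lines.
Context {R : realType} {n : nat} {X : topologicalType} {O : @orbifold R n X}.
Notation E n := ('cV[R]_(2 * n)).

Lemma Ck_on_subset (V W : normedModType R) k (U U' : set V) (f : V -> W) :
  U `<=` U' -> Ck_on k U' f -> Ck_on k U f.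
Proof.
move=> UU'; elim: k f => [|k IH] f /=; first by move=> h x /UU'; exact: h.
by move=> [h1 h2]; split=> [x /UU'|v]; [exact: h1|exact: IH].
Qed.

Lemma csmooth_on_subset (V : normedModType R) (U U' : set V) (f : V -> R[i]) :
  U `<=` U' -> csmooth_on U' f -> csmooth_on U f.
Proof. by move=> UU' [fr fi]; split=> k; apply: (Ck_on_subset UU'). Qed.

Lemma smooth_section_subset (B : line_bundle O) (i : chart O) (U U' : set (E n))
    (s : section_on B i) :
  open U -> U `<=` U' -> smooth_section U' s -> smooth_section U s.
Proof.
move=> Uo UU' [_ U'd sP]; split=> //; first exact: subset_trans U'd.
move=> W e eW; have [f fs fE] := sP W e eW; exists f => [|x /UU']; last exact: fE.
by apply: csmooth_on_subset fs; exact: setSI.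
Qed.

Lemma smooth_section_frame (B : line_bundle O) (i : chart O) (U : set (E n))
    (e : section_on B i) : frame U e -> smooth_section U e.
Proof.
move=> eU; have [Uo Ud] := frame_open eU; split=> // W e' eW.
have [f fs fE] := frame_trans eW eU; exists f => [|x Ux Wx]; last exact: fE.
by rewrite setIC.
Qed.

(** [lift_comp] compares two factorizations of one map, so [g] followed by [g^-1] is compared with
    the unit applied twice, whose lifts are trivial by [lift_id]. Dependent pairs bridge fibres over
    points that are only provably equal. *)
Lemma lift_act_cancel (B : line_bundle O) (i : chart O) (g : chart_grp i) x
    (a : fib B i x) : chart_dom i x ->
  existT (fib B i) (act_emb (g^-1)%g (act_emb g x))
    (fib_lift (act_emb (g^-1)%g) (fib_lift (act_emb g) a)) = existT (fib B i) x a.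
Proof.
move=> xd; pose u : embedding i i := act_emb 1%g.
have u1 y : chart_dom i y -> u y = y by exact: act_one.
have gu y : chart_dom i y -> act_emb (g^-1)%g (act_emb g y) = u (u y).
  by move=> yd; rewrite !u1 // /= -act_mul // mulVg act_one.
rewrite (lift_comp gu a xd) (lift_id u1 (fib_lift u a) (emb_dom u xd)).
exact: lift_id.
Qed.

(** Computes the closing identification of a chart loop: with [ksi] the phase gained along the path,
    the lift of [g^-1] subtracts the phase [zeta] of [g]. This is the origin of the minus signs
    before [alpha] and [beta]. *)
Lemma lift_inv_phase (B : line_bundle O) (i : chart O) (g : chart_grp i) x y
    (a : fib B i x) (b : fib B i y) (ksi zeta : R) : chart_dom i x ->
  existT (fib B i) (act_emb g x) (fib_lift (act_emb g) a)
    = existT (fib B i) y (cis zeta *: b) ->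
  existT (fib B i) (act_emb (g^-1)%g y) (fib_lift (act_emb (g^-1)%g) (cis ksi *: b))
    = existT (fib B i) x (cis (ksi - zeta) *: a).
Proof.
move=> xd e; have xy : act_emb g x = y := projT1_eq e.
move: b e; rewrite -xy => b e0; have {e0} e := existT_inj e0.
have -> : cis ksi *: b = fib_lift (act_emb g) (cis (ksi - zeta) *: a).
  rewrite (linearZP (fun c a b => lift_linear (act_emb g) c a b xd)) e scalerA.
  by rewrite -cisD subrK.
exact: lift_act_cancel.
Qed.

Lemma is_derive_comp_path (V : normedModType R) (f : V -> R^o) (g : R^o -> V) (t : R^o) :
  differentiable g t -> differentiable f (g t) ->
  is_derive t 1 (f \o g) ('D_('D_1 g t) f (g t)).
Proof.
move=> dg df; have dfg := differentiable_comp dg df.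
apply: DeriveDef; first exact: diff_derivable.
by rewrite !deriveE // diff_comp.
Qed.

Lemma is_cderive_comp_path (V : normedModType R) (U : set V) (f : V -> R[i])
    (g : R^o -> V) (t : R^o) :
  csmooth_on U f -> U (g t) -> differentiable g t ->
  is_cderive (f \o g) t (dC f (g t) ('D_1 g t)).
Proof.
move=> [/(_ 1) [fr _] /(_ 1) [fi _]] Ugt dg.
split; first by have := is_derive_comp_path dg (fr _ Ugt).
by have := is_derive_comp_path dg (fi _ Ugt).
Qed.

Variables (om : symplectic_form O) (P : real_polarization om).
Variables (hbar : R) (L : prequantum_bundle om hbar).

(** The path is smooth on an open set containing [I01], so its velocity is continuous at the
    endpoints too. The matrix product is then handled as a finite sum of products of coordinates. *)
Lemma action_density_continuous i (g : R -> E n) (theta : E n -> 'rV[R]_(2 * n)) t :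
  leaf_path P i g -> smooth_on (chart_dom i) theta -> I01 t ->
  {for t, continuous (fun t => (theta (g t) *m 'D_(1 : R^o) (g : R^o -> E n) t) 0 0)}.
Proof.
move=> [[U [Uo IU gs]] gP] ths It.
have gc : {for t, continuous (g : R^o -> E n)} by apply: (gs 0); exact: IU.
have vc : {for t, continuous (fun t : R^o => 'D_1 (g : R^o -> E n) t)}.
  by have [_ /(_ 1)] := gs 1; apply; exact: IU.
have tc : {for t, continuous (theta \o (g : R^o -> E n))}.
  by apply: continuous_comp => //; apply: (ths 0); have [] := gP t It.
rewrite (_ : (fun _ => _) = fun s : R^o =>
  \sum_j (theta (g s) 0 j * 'D_1 (g : R^o -> E n) s j 0)); last first.
  by apply/funext => s; rewrite mxE.
apply: cvg_big => [|j _]; [exact: add_continuous|apply: cvgM].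
- apply: (@continuous_comp _ _ _ (theta \o (g : R^o -> E n))
    (fun A : 'rV[R]_(2 * n) => A 0 j) t tc).
  exact: coord_continuous.
- apply: (@continuous_comp _ _ _ _ (fun A : 'cV[R]_(2 * n) => A j 0) t vc).
  exact: coord_continuous.
Qed.

(** With [F] a primitive of the action density, differentiating the phase yields [i/hbar] times that
    density, which cancels the connection form [-i/hbar theta]. *)
Lemma parallel_phase i (g : R -> E n) (theta : E n -> 'rV[R]_(2 * n))
    (s0 : section_on L i) :
  leaf_path P i g -> smooth_on (chart_dom i) theta ->
  smooth_section (chart_dom i) s0 -> connection_form s0 theta ->
  exists F : R -> R, [/\ F 0 = 0, F 1 = path_integral theta g &
    parallel (@pq_conn _ _ _ _ _ _ L) (fun t => cis (F t / hbar) *: s0 (g t))].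
Proof.
move=> gl ths s0s s0c.
have hc t := @action_density_continuous i g theta t gl ths.
have [F [F0 F1 FD]] := primitive_unit_interval hc.
exists F; split=> // t It U e eU Ugt.
have [_ _ /(_ U e eU) [f fs fE]] := s0s.
have [[V [Vo IV gs]] /(_ t It)[gd _]] := gl.
have [Uo Ud] := frame_open eU.
pose v := 'D_(1 : R^o) (g : R^o -> E n) t.
pose h := (theta (g t) *m v) 0 0.
have dg : differentiable (g : R^o -> E n) t by have [gd1 _] := gs 1; apply: gd1; exact: IV.
have fD := is_cderive_comp_path fs (conj gd Ugt) dg.
have FhD : is_derive t 1 (fun s => F s / hbar) (h / hbar).
  apply: (is_derive_eq (is_deriveM (FD t It) (is_derive_cst (hbar^-1) t 1))).
  by rewrite scaler0 add0r /GRing.scale /= mulrC.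
have /is_cderiveP[pr pi pE] := is_cderiveM (is_cderive_cis FhD) fD.
(* In the frame [e], the coefficient is the phase times the coefficient [f] of [s0]. *)
exists (fun s => cis (F s / hbar) * f (g s)); split=> //.
- have gc : {for t, continuous (g : R^o -> E n)} by apply: (gs 0); exact: IV.
  have /gc Ug : nbhs (g t) U by exact: open_nbhs_nbhs.
  near=> s => _; have Us : U (g s) by near: s.
  by rewrite fE ?scalerA //; exact: Ud.
(* Near [g t] one has [s0 = f e], so locality and the Leibniz rule expand the derivative of [s0] in
   the frame [e]. *)
- have sE : pq_conn s0 v (g t) = dC f (g t) v *: e (g t) + f (g t) *: pq_conn e v (g t).
    rewrite -(conn_leibniz (pq_connP L) (smooth_section_frame eU) _) //; last first.
      by apply: csmooth_on_subset fs => y Uy; split=> //; exact: Ud.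
    have s0U := smooth_section_subset Uo Ud s0s.
    by apply: (conn_local (pq_connP L) s0U) => // y Uy; apply: fE => //; exact: Ud.
  rewrite pE /= scalerDl -!scalerA -addrA -scalerDr -/v -sE (s0c _ _ gd) fE //.
  rewrite -/h !scalerA -scalerDl -mulrDl (_ : _ + _ = 0) ?mul0r ?scale0r //.
  rewrite mulrC -mulrDr (_ : _ + _ = 0) ?mulr0 //.
  by congr Complex; rewrite /= ?addr0 ?subrr.
Unshelve. all: by end_near. Qed.

End Lines.

(** * Orbifold paths in the leaf, and corrected transport as a relation *)

Section LineBundleTransport.
Context {R : realType} {n : nat} {X : topologicalType} {O : @orbifold R n X}.
Notation E n := ('cV[R]_(2 * n)).

Lemma parallelZ (B : line_bundle O)
    (nabla : forall i, section_on B i -> E n -> section_on B i)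
    (i : chart O) (g : R -> E n) (u : forall t, fib B i (g t)) (c : R[i]) :
  parallel nabla u -> parallel nabla (fun t => c *: u t).
Proof.
move=> up t It U e eU Ugt; have [f [fu fr fi fd]] := up t It U e eU Ugt.
have /is_cderiveP[cr ci cd] := is_cderiveM (is_cderive_cst c t)
  ((is_cderiveP f t _).2 (And3 fr fi erefl)).
exists (fun s => c * f s); split=> //.
- by apply: filterS fu => s us Is; rewrite us // scalerA.
- rewrite cd mul0r add0r.
  by rewrite -!scalerA -scalerDr fd scaler0.
Qed.

Variables (om : symplectic_form O) (P : real_polarization om).
Variables (hbar : R) (L : prequantum_bundle om hbar).
Variables (delta : half_form_bundle P).
Variables (Lf : set X) (mu : maslov_index P Lf).
Variable M : chart O -> E n -> lmodType R[i].
Variable ten : forall i x, fib L i x -> fib delta i x -> M i x.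
Hypothesis ten_tensor : forall i x, chart_dom i x -> is_tensor_product (@ten i x).

Local Notation transport := (transport mu ten).
Local Notation word_transport := (word_transport mu ten).

(** Compatibility provides a third chart embedded in both: the first embedding is walked backwards,
    the second forwards. *)
Lemma orbipath_fibre p q : in_dom p -> in_dom q -> pt_image p = pt_image q ->
  exists w, orbipath P p w q.
Proof.
case: p q => [i x] [j y]; rewrite /in_dom /pt_image /= => xi yj xy.
have [k [z [l [m [zk /= <- <-]]]]] := orb_compatible xi yj xy.
by exists [:: (Jump l z, true); fwd (Jump m z)].
Qed.

Definition tot_scale (c : R[i]) (a : Defs.total M) : Defs.total M :=
  tot (c *: projT2 a).

Lemma arrow_dom a : arrow_ok P a -> in_dom (asrc a) /\ in_dom (atgt a).
Proof.
case: a => [i g|i j l x] /= => [[_ g01]|xd]; last by split=> //; exact: emb_dom.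
by split; [have [] := g01 0|have [] := g01 1]; rewrite /I01/= ?lexx ?ler01.
Qed.

Lemma orbipath_dom p w q : orbipath P p w q -> in_dom p -> in_dom q.
Proof.
elim: w p => [p <- //|[a b] w IH p [/arrow_dom[sd td] _ h] _].
by apply: IH h _; rewrite /ltgt; case: ifP.
Qed.

(** [is_leaf] fixes one base point. Reversing paths, and joining representatives of the same point
    of [X] by chart changes, lets any point of the leaf in any chart replace it. *)
Lemma leaf_connected p q : is_leaf P Lf -> in_dom p -> Lf (pt_image p) ->
  in_dom q -> (Lf (pt_image q) <-> exists w, orbipath P p w q).
Proof.
move=> [r [rd ->]] pd [u [p' [ru p'p]]] qd.
have [u' pu'] := orbipath_fibre (orbipath_dom ru rd) pd p'p.
have rp := orbipath_cat ru pu'; split=> [[v [q' [rv q'q]]]|[w pw]].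
  have [v' qv'] := orbipath_fibre (orbipath_dom rv rd) qd q'q.
  exists (winv (u ++ u') ++ (v ++ v')).
  exact: orbipath_cat (orbipath_winv rp) (orbipath_cat rv qv').
by exists ((u ++ u') ++ w), q; split=> //; exact: orbipath_cat pw.
Qed.

Lemma polarized_word_transport (s : forall i x, M i x) p w q :
  is_leaf P Lf -> polarized_section mu ten s -> in_dom p -> Lf (pt_image p) ->
  orbipath P p w q ->
  word_transport w (@tot R n X O M p (s p.1 p.2)) (@tot R n X O M q (s q.1 q.2)).
Proof.
move=> LfP sP; elim: w p => [p _ _ -> //|a w IH p pd pL [aok sa aw]].
have pa : orbipath P p [:: a] (ltgt a) by [].
have ad := orbipath_dom pa pd.
have aL : Lf (pt_image (ltgt a)) by apply/(leaf_connected LfP pd pL ad); exists [:: a].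
exists (@tot R n X O M (ltgt a) (s (ltgt a).1 (ltgt a).2)).
split; last exact: IH.
rewrite -sa in pL *; case: a aok pL aL {sa aw pa ad} => [a []] /= aok pL aL; exact: sP.
Qed.

Lemma fibre_line (p : chart_point O) : in_dom p ->
  exists2 e : M p.1 p.2, e != 0 & forall a, exists c, a = c *: e.
Proof.
move=> pd; have [e e0 eA] := fib_line L pd; have [f f0 fB] := fib_line delta pd.
by have [] := tensor_of_lines (ten_tensor pd) e0 eA f0 fB; exists (ten e f).
Qed.

Lemma line_neq0 (p : chart_point O) (e a : M p.1 p.2) : in_dom p -> e != 0 ->
  exists c, a = c *: e.
Proof. by move=> /fibre_line[f f0 fA] e0; exact: (line_span fA e0). Qed.

Lemma transport_tag a x y : transport a x y ->
  [/\ arrow_ok P a, projT1 x = asrc a & projT1 y = atgt a].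
Proof. by case. Qed.

(** The scalar is placed on the factor in [L], where multiples of parallel sections are parallel and
    lifts are linear. *)
Lemma transport_scale c a x y : transport a x y ->
  transport a (tot_scale c x) (tot_scale c y).
Proof.
case=> [i g u v gl up vp|i j l z u v zd]; rewrite /tot_scale /=.
- have gd t : I01 t -> is_bilinear (@ten i (g t)).
    by move=> It; have [_ /(_ t It) [/ten_tensor[]]] := gl.
  rewrite -(bilinearZl (gd 0 _)) ?/I01/= ?lexx ?ler01//.
  rewrite -(bilinearZl (gd 1 _)) ?/I01/= ?lexx ?ler01//.
  exact: (transport_seg mu ten gl (parallelZ c up) vp).
- have [zb _] := ten_tensor zd; have [zb' _] := ten_tensor (emb_dom l zd).
  rewrite -(bilinearZl zb) -(bilinearZl zb').
  rewrite -(linearZP (fun c a b => lift_linear l c a b zd)).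
  exact: transport_jump.
Qed.

Lemma word_transport_tag p w q x y : orbipath P p w q -> word_transport w x y ->
  projT1 x = p -> projT1 y = q.
Proof.
elim: w p x => [p x /= -> -> //|[a b] w IH p x [_ _ h] [c [ac cy]] _].
by apply: IH h cy _; case: b ac => /= /transport_tag[].
Qed.

Lemma word_transport_scale c w x y : word_transport w x y ->
  word_transport w (tot_scale c x) (tot_scale c y).
Proof.
elim: w x => [x /= -> //|[a b] w IH x [z [az zy]]].
exists (tot_scale c z); split; last exact: IH.
by case: b az; exact: transport_scale.
Qed.

Lemma word_transport_cat u v x y : word_transport (u ++ v) x y <->
  exists z, word_transport u x z /\ word_transport v z y.
Proof.
elim: u x => [x /=|a u IH x /=].
  by split=> [h|[z [-> ]]//]; exists x.
split=> [[c [ac /IH[z [cz zy]]]]|[z [[c [ac cz]] zy]]].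
  by exists z; split=> //; exists c.
by exists c; split=> //; apply/IH; exists z.
Qed.

Lemma word_transport_inv w x y : word_transport w x y ->
  word_transport (winv w) y x.
Proof.
elim: w x => [x /= -> //|a w IH x [c [ac /IH cy]]].
rewrite /winv /= rev_cons -cats1; apply/word_transport_cat; exists c; split=> //.
by exists x; split=> //; case: a ac => [a []].
Qed.

Lemma total_at (p : chart_point O) (x : Defs.total M) : projT1 x = p ->
  exists a : M p.1 p.2, x = tot a.
Proof. by case: x => q a /= <-; exists a. Qed.

Lemma tot_inj (p : chart_point O) : injective (@tot R n X O M p).
Proof. by move=> a b; exact: existT_inj. Qed.

(** * Transport along paths from the base point, and the holonomy criterion *)

Section Holonomy.
Variables (p0 : chart_point O) (p0_dom : in_dom p0).
Variable Hol : pi1 P p0 -> R[i].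
Hypothesis HolP : is_corrected_holonomy mu ten Hol.

(* The loop [w ++ winv w] has a well-defined holonomy, so transport along [w]
   exists; no differential equation has to be solved. *)
Lemma word_transport_total w q (a : M p0.1 p0.2) : orbipath P p0 w q ->
  exists c : M q.1 q.2, word_transport w (tot a) (tot c).
Proof.
move=> pw; pose l := Loop (orbipath_cat pw (orbipath_winv pw)).
have /word_transport_cat[z [az _]] := (hol_transport HolP l a _).2 erefl.
have [c zc] := total_at (word_transport_tag pw az erefl).
by exists c; rewrite -zc.
Qed.

Lemma hol1 : Hol 1%g = 1.
Proof.
have /eqP := hol_mul HolP 1%g 1%g; rewrite mul1g -{1}[Hol _]mulr1.
have h0 : Hol 1%g != 0.
  by rewrite -normr_eq0 (hol_unitary HolP) oner_eq0.
by rewrite (inj_eq (mulfI h0)) eq_sym => /eqP.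
Qed.

Lemma holV c : Hol c = 1 -> Hol (c^-1)%g = 1.
Proof. by move=> hc; have := hol_mul HolP c (c^-1)%g; rewrite mulgV hol1 hc mul1r. Qed.

Lemma hol_nullhomotopic (l : loop P p0) : homotopic P p0 p0 l [::] ->
  Hol (loop_class l) = 1.
Proof. by rewrite -hol1 => /(loop_classP l (loop_one P p0)) ->. Qed.

(** Going out from [b] and returning to [a] is transport along a null-homotopic loop, hence the
    identity. *)
Lemma word_transport_inj w q (a b : M p0.1 p0.2) (c : M q.1 q.2) :
  orbipath P p0 w q -> word_transport w (tot a) (tot c) ->
  word_transport w (tot b) (tot c) -> a = b.
Proof.
move=> pw ac bc; pose l := Loop (orbipath_cat pw (orbipath_winv pw)).
have /(hol_transport HolP l): word_transport l (tot b) (tot a).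
  by apply/word_transport_cat; exists (tot c); split=> //; exact: word_transport_inv.
by rewrite (hol_nullhomotopic (homotopic_mulV pw : homotopic P p0 p0 l [::])) scale1r.
Qed.

(** If [c] were 0, scaling by 0 would show that the zero vector has the same transport as [a],
    against injectivity. *)
Lemma word_transport_neq0 w q (a : M p0.1 p0.2) (c : M q.1 q.2) :
  orbipath P p0 w q -> word_transport w (tot a) (tot c) -> a != 0 -> c != 0.
Proof.
move=> pw ac; apply: contraNneq => c0.
have := word_transport_scale 0 ac; rewrite /tot_scale /= c0 !scale0r => h.
by apply/eqP; apply: (word_transport_inj pw _ h); rewrite -c0.
Qed.

Lemma word_transport_surj w q (c : M q.1 q.2) : orbipath P p0 w q ->
  exists a : M p0.1 p0.2, word_transport w (tot a) (tot c).
Proof.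
move=> pw; have [e e0 _] := fibre_line p0_dom.
have [d ed] := word_transport_total e pw.
have [z ->] := line_neq0 c (orbipath_dom pw p0_dom) (word_transport_neq0 pw ed e0).
by exists (z *: e); exact: (word_transport_scale z ed).
Qed.

(** [transport] is only a relation, so its single-valuedness has to be derived. Both values are
    multiples of the transport [f] of a generator [e]; by injectivity [a] is the corresponding
    multiple of [e], which fixes the scalar. *)
Lemma word_transport_fun w q (a : M p0.1 p0.2) (c d : M q.1 q.2) :
  orbipath P p0 w q -> word_transport w (tot a) (tot c) ->
  word_transport w (tot a) (tot d) -> c = d.
Proof.
move=> pw ac ad; have qd := orbipath_dom pw p0_dom.
have [e e0 _] := fibre_line p0_dom; have [f ef] := word_transport_total e pw.
have f0 := word_transport_neq0 pw ef e0.
have [[y yE] [z zE]] := (line_neq0 c qd f0, line_neq0 d qd f0).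
rewrite yE zE; congr (_ *: _).
have ay : a = y *: e.
  by apply: (word_transport_inj pw ac); rewrite yE; exact: (word_transport_scale y ef).
have az : a = z *: e.
  by apply: (word_transport_inj pw ad); rewrite zE; exact: (word_transport_scale z ef).
apply/eqP; rewrite -subr_eq0; have /eqP := etrans (esym ay) az.
by rewrite -subr_eq0 -scalerBl scaler_eq0 (negbTE e0) orbF.
Qed.

(** Conjugating by [w] moves a loop at [q] to the base point. Transport along [w] commutes with
    scalars, so the holonomy acts by the same number on the fibre at [q]. *)
Lemma word_transport_loop w q (l : loop P p0) (c d : M q.1 q.2) u :
  orbipath P p0 w q -> loop_word l = w ++ u ++ winv w ->
  word_transport u (tot c) (tot d) -> d = Hol (loop_class l) *: c.
Proof.
move=> pw lE cd.
have [[a ac] [b bd]] := (word_transport_surj c pw, word_transport_surj d pw).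
have /(hol_transport HolP l) bE : word_transport l (tot a) (tot b).
  rewrite lE; apply/word_transport_cat; exists (tot c); split=> //.
  apply/word_transport_cat; exists (tot d); split=> //.
  exact: word_transport_inv.
apply: (word_transport_fun pw bd); rewrite bE.
exact: (word_transport_scale (Hol (loop_class l)) ac).
Qed.

Lemma section_hol_trivial : is_leaf P Lf -> Lf (pt_image p0) ->
  has_nonzero_polarized_section mu ten <-> forall c, Hol c = 1.
Proof.
move=> LfP p0L; split=> [[s [sP [i [x [xd xL sx]]]]] c|hol_triv].
  have [w p0w] := (leaf_connected LfP p0_dom p0L (xd : in_dom (i, x))).1 xL.
  (* A zero value at [p0] would be transported to zero at [(i, x)], where the section is
     non-zero. *)
  have s0 : s p0.1 p0.2 != 0.
    apply: contraNneq sx => s0.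
    have := polarized_word_transport LfP sP p0_dom p0L p0w; rewrite s0 => h.
    apply/eqP; apply: (word_transport_fun p0w h).
    by have := word_transport_scale 0 h; rewrite /tot_scale /= !scale0r.
  have := polarized_word_transport LfP sP p0_dom p0L (loopP (pi1_repr c)).
  move=> /(hol_transport HolP (pi1_repr c)); rewrite pi1_reprK.
  move=> /eqP; rewrite -subr_eq0 -{1}[s _ _]scale1r -scalerBl scaler_eq0.
  by rewrite (negbTE s0) orbF subr_eq0 eq_sym => /eqP.
have [e e0 _] := fibre_line p0_dom.
(* Path independence: going out along [u] and back along [v] is a loop, which fixes [e] by
   triviality of the holonomy. *)
have indep u v q (a b : M q.1 q.2) : orbipath P p0 u q -> orbipath P p0 v q ->
    word_transport u (tot e) (tot a) -> word_transport v (tot e) (tot b) -> a = b.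
  move=> pu pv ea eb; have [f fb] := word_transport_surj a pv.
  pose l := Loop (orbipath_cat pu (orbipath_winv pv)).
  have /(hol_transport HolP l): word_transport l (tot e) (tot f).
    by apply/word_transport_cat; exists (tot a); split=> //; exact: word_transport_inv.
  rewrite hol_triv scale1r => fe; rewrite fe in fb.
  exact: (word_transport_fun pv fb eb).
(* A section assigns a value to every pair [(i, x)]; away from the leaf the value is 0. *)
have sE i x : exists a : M i x, chart_dom i x -> Lf (chart_proj i x) ->
    forall w, orbipath P p0 w (i, x) -> word_transport w (tot e) (@tot R n X O M (i, x) a).
  have [[xd xL]|nxL] := pselect (chart_dom i x /\ Lf (chart_proj i x)); last first.
    by exists 0 => xd xL; case: nxL.
  have [w p0w] := (leaf_connected LfP p0_dom p0L (xd : in_dom (i, x))).1 xL.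
  have [a ea] := word_transport_total e p0w; exists a => _ _ v p0v.
  have [b eb] := word_transport_total e p0v.
  by rewrite (indep _ _ _ _ _ p0w p0v ea eb).
pose s i x := projT1 (cid (sE i x)).
have sP q w : in_dom q -> Lf (pt_image q) -> orbipath P p0 w q ->
    word_transport w (tot e) (@tot R n X O M q (s q.1 q.2)).
  by case: q => i x xd xL; rewrite /s /=; case: cid => c cE; exact: cE.
exists s; split=> [a aok aL|]; last first.
  exists p0.1, p0.2; split=> //.
  have es : tot e = tot _ := sP p0 [::] p0_dom p0L erefl.
  by rewrite -(tot_inj es).
have [ad atd] := arrow_dom aok.
have [w p0w] := (leaf_connected LfP p0_dom p0L ad).1 aL.
(* Extending a path to the source of [a] by [a] itself gives a path to its target; splitting the
   transport of [e] along it isolates the step across [a]. *)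
have p0wa : orbipath P p0 (w ++ [:: fwd a]) (atgt a) by exact: orbipath_cat p0w _.
have atL : Lf (pt_image (atgt a)).
  by apply/(leaf_connected LfP p0_dom p0L atd); exists (w ++ [:: fwd a]).
have [f ef] := word_transport_total e p0wa.
have fE := word_transport_fun p0wa ef (sP _ _ atd atL p0wa).
have /word_transport_cat[z [ez [y [zy yf]]]] := ef.
have [c zc] := total_at (word_transport_tag p0w ez erefl).
rewrite zc in ez zy; rewrite -(word_transport_fun p0w ez (sP _ _ ad aL p0w)).
by rewrite -fE -yf.
Qed.

(** The classes with trivial holonomy form a subgroup, so containing [S] forces it to be
    everything. *)
Lemma hol_trivial_on_generators (S : set (pi1 P p0)) : generates S ->
  (forall c, Hol c = 1) <-> (forall c, S c -> Hol c = 1).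
Proof.
move=> Sgen; split=> [h c _|h]; first exact: h.
apply: (Sgen [set c | Hol c = 1]) => //=; first exact: hol1.
  by move=> c d hc hd; rewrite (hol_mul HolP) hc hd mulr1.
exact: holV.
Qed.

Lemma tot_ten_eq i x y (a : fib L i x) (b : fib delta i x) (a' : fib L i y)
    (b' : fib delta i y) :
  existT (fib L i) x a = existT (fib L i) y a' ->
  existT (fib delta i) x b = existT (fib delta i) y b' ->
  @tot R n X O M (i, x) (ten a b) = @tot R n X O M (i, y) (ten a' b').
Proof.
move=> e; have xy : x = y := projT1_eq e.
by move: a' b' e; rewrite -xy => a' b' e e'; rewrite (existT_inj e) (existT_inj e').
Qed.

(** The tensor of the two frames at [gamma 0] is followed along the segment and then through the
    jump by [g^-1]. It returns as a multiple of itself, and that multiple is the holonomy. *)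
Lemma hol_chart_loop (w : loop P p0) (i : chart O) (g : chart_grp i)
    (gamma : R -> E n) (k : seq (letter O)) theta (s0 : section_on L i)
    (nu0 : forall t, fib delta i (gamma t)) (alpha beta : R) :
  orbipath P p0 k (i, gamma 0) -> leaf_path P i gamma ->
  loop_word w = k ++ [:: fwd (Seg i gamma);
                         fwd (Jump (act_emb (g^-1)%g) (gamma 1))] ++ winv k ->
  smooth_on (chart_dom i) theta -> unitary_frame s0 -> connection_form s0 theta ->
  parallel (@hf_conn _ _ _ _ _ _ delta) nu0 -> nu0 0 != 0 ->
  existT (fib L i) (act_emb g (gamma 0)) (fib_lift (act_emb g) (s0 (gamma 0)))
    = existT (fib L i) (gamma 1) (cis (2 * pi * alpha) *: s0 (gamma 1)) ->
  existT (fib delta i) (act_emb g (gamma 0)) (fib_lift (act_emb g) (nu0 0))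
    = existT (fib delta i) (gamma 1) (cis (2 * pi * beta) *: nu0 1) ->
  Hol (loop_class w) = cis (path_integral theta gamma / hbar - 2 * pi * alpha
    + (- (pi * (mu i gamma)%:~R / 2) - 2 * pi * beta)).
Proof.
move=> p0k gl wE ths [s0s s0u] s0c nup nu00 sg nug.
have [g0 g1] : chart_dom i (gamma 0) /\ chart_dom i (gamma 1) :=
  arrow_dom (a := Seg i gamma) gl.
have [F [F0 F1 Fp]] := parallel_phase gl ths s0s s0c.
have seg := transport_seg mu ten gl Fp nup.
rewrite F0 F1 mul0r cis0 scale1r in seg.
have jump := transport_jump mu ten (act_emb (g^-1)%g)
  (cis (path_integral theta gamma / hbar) *: s0 (gamma 1))
  (cis (- (pi * (mu i gamma)%:~R / 2)) *: nu0 1) g1.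
(* This rewrites the end of the jump as a vector over [gamma 0], with both closing phases
   included. *)
rewrite (tot_ten_eq (lift_inv_phase _ g0 sg) (lift_inv_phase _ g0 nug)) in jump.
have [tb _] := ten_tensor g0.
rewrite (bilinearZl tb) (bilinearZr tb) scalerA -cisD in jump.
set phi := _ + _ in jump *.
have wt : word_transport [:: fwd (Seg i gamma); fwd (Jump (act_emb (g^-1)%g) (gamma 1))]
    (@tot R n X O M (i, gamma 0) (ten (s0 (gamma 0)) (nu0 0)))
    (@tot R n X O M (i, gamma 0) (cis phi *: ten (s0 (gamma 0)) (nu0 0))).
  by eexists; split; [exact: seg|eexists; split; [exact: jump|]].
have c0 : ten (s0 (gamma 0)) (nu0 0) != 0.
  (* A vanishing frame would have Hermitian norm 0 instead of 1. *)
  have s00 : s0 (gamma 0) != 0.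
    apply/eqP => s00; have := s0u _ g0; rewrite s00.
    have := herm_linear (p := L) 1 0 0 (0 : fib L i (gamma 0)) g0.
    rewrite scaler0 addr0 mul1r => /eqP; rewrite -{1}[herm 0 0]addr0.
    by rewrite (inj_eq (addrI _)) eq_sym => /eqP -> /eqP; rewrite eq_sym oner_eq0.
  have [e _ eL] := fib_line L g0; have [f _ fd] := fib_line delta g0.
  by have [] := tensor_of_lines (ten_tensor g0) s00 (line_span eL s00)
    nu00 (line_span fd nu00).
have /eqP := word_transport_loop p0k wE wt.
by rewrite -subr_eq0 -scalerBl scaler_eq0 (negbTE c0) orbF subr_eq0 => /eqP.
Qed.

End Holonomy.
End LineBundleTransport.

Theorem corollary5p16 (R : realType) (n : nat) (X : topologicalType)
    (O : @orbifold R n X) (om : symplectic_form O) (P : real_polarization om)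
    (hbar : R) (hbar_gt0 : 0 < hbar)
    (L : prequantum_bundle om hbar) (delta : half_form_bundle P)
    (Lf : set X) (Lf_leaf : is_leaf P Lf)
    (mu : maslov_index P Lf)
    (M : chart O -> 'cV[R]_(2 * n) -> lmodType R[i])
    (ten : forall i x, fib L i x -> fib delta i x -> M i x)
    (ten_tensor : forall i x, chart_dom i x -> is_tensor_product (ten i x))
    (compat : transport_compatible mu ten)
    (p0 : chart_point O) (p0_dom : in_dom p0) (p0_leaf : Lf (pt_image p0))
    (Hol : pi1 P p0 -> R[i]) (HolP : is_corrected_holonomy mu ten Hol) :
  (has_nonzero_polarized_section mu ten <-> forall c, Hol c = 1) /\
  (forall S : set (pi1 P p0), generates S ->
    (has_nonzero_polarized_section mu ten <-> forall c, S c -> Hol c = 1) /\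
    (* k reads the base point in the chart i of gamma; it is empty if p0 = (i, x0) *)
    forall (c : pi1 P p0) (i : chart O) (x0 : 'cV[R]_(2 * n)) (g : chart_grp i)
      (gamma : R -> 'cV[R]_(2 * n)) (k : seq (letter O)) (w : loop P p0),
      S c -> c = loop_class w ->
      all chart_change k -> orbipath P p0 k (i, x0) ->
      leaf_path P i gamma -> gamma 0 = x0 -> gamma 1 = chart_act g x0 ->
      loop_word w = (k ++ [:: fwd (Seg i gamma);
                              fwd (Jump (act_emb (g^-1)%g) (gamma 1))]
                       ++ winv k)%SEQ ->
    forall (theta : 'cV[R]_(2 * n) -> 'rV[R]_(2 * n)) (s0 : section_on L i)
      (nu0 : forall t, fib delta i (gamma t)) (alpha beta : R),
      symplectic_potential om i theta -> invariant_form i theta ->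
      unitary_frame s0 -> connection_form s0 theta ->
      parallel (@hf_conn _ _ _ _ _ _ delta) nu0 ->
      (forall t, I01 t -> nu0 t != 0) ->
      (forall x, chart_dom i x ->
         fib_lift (act_emb g) (s0 x) = cis (2 * pi * alpha) *: s0 (chart_act g x)) ->
      existT (fib delta i) (act_emb g (gamma 0)) (fib_lift (act_emb g) (nu0 0))
        = existT (fib delta i) (gamma 1) (cis (2 * pi * beta) *: nu0 1) ->
      (Hol c = 1 <->
       exists m : int,
         (2 * pi * hbar)^-1 * path_integral theta gamma
         - alpha - beta - (mu i gamma)%:~R / 4 = m%:~R)).
Proof.
have main := section_hol_trivial ten_tensor p0_dom HolP Lf_leaf p0_leaf.
split=> // S Sgen; split.
  by rewrite main; exact: hol_trivial_on_generators HolP S Sgen.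
move=> c i x0 g gamma k w _ -> _ p0k gl gx0 g1 wE theta s0 nu0 alpha beta.
move=> [ths _] _ s0u s0c nup nu_neq0 s0g nug; subst x0.
have I0 : I01 (0 : R) by rewrite /I01 /= lexx ler01.
have [g0 _] := gl.2 0 I0.
have sg : existT (fib L i) (act_emb g (gamma 0)) (fib_lift (act_emb g) (s0 (gamma 0)))
    = existT (fib L i) (gamma 1) (cis (2 * pi * alpha) *: s0 (gamma 1)).
  by rewrite s0g // g1.
rewrite (hol_chart_loop ten_tensor p0_dom HolP p0k gl wE ths s0u s0c nup
  (nu_neq0 0 I0) sg nug).
rewrite cis_eq1; set I := path_integral _ _.
have pi0 : pi != 0 :> R by rewrite gt_eqF ?pi_gt0.
have pi2 : 2 * pi != 0 :> R by rewrite mulf_neq0.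
have hbar0 : hbar != 0 by rewrite gt_eqF.
(* Factoring [2 pi] out of the total phase turns the criterion of [cis_eq1] into integrality of the
   displayed quantity. *)
have -> : I / hbar - 2 * pi * alpha + (- (pi * (mu i gamma)%:~R / 2) - 2 * pi * beta)
    = 2 * pi * ((2 * pi * hbar)^-1 * I - alpha - beta - (mu i gamma)%:~R / 4).
  by move: (pi : R) pi0 => q q0; field; rewrite hbar0 q0.
by split=> -[m mE]; exists m; [exact: (mulfI pi2)|rewrite mE].
Qed.
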